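(* Let $f\in\mathrm{LC}$ and let $\mathcal T$ be a topology on $\mathrm{LC}$ such that the induced local skew-product flow on $\mathrm{Hull}_{(\mathrm{LC},\mathcal T)}(f)\times\mathbb R^N$ is continuous. Assume that for every $g\in\{f_s\mid s\ge0\}\cup\mathbb O(f)$ and every $x_0\in\mathbb R^N$ the solution $x(\cdot,g,x_0)$ is defined on $[0,\infty)$. If there is $\tau\in\mathbb R$ such that the solutions of $\dot x=f(t,x)$ are uniformly ultimately bounded on $[\tau,\infty)$, then for every $g\in\mathbb O(f)$ the solutions of $\dot x=g(t,x)$ are uniformly ultimately bounded and the process $S_g$ has a bounded pullback attractor.
   Context: $\mathrm{LC}$: Borel measurable $f:\mathbb R\times\mathbb R^N\to\mathbb R^N$ such that for every compact $K$ there are $m^K,l^K\in L^1_{loc}$ with $|f(t,x)|\le m^K(t)$ and $|f(t,x)-f(t,y)|\le l^K(t)|x-y|$ for $x,y\in K$, a.e. $t$. $f_t(s,x)=f(s+t,x)$. For $g\in\mathrm{LC}$, $x(\cdot,g,x_0)$ denotes the unique maximal Carathéodory solution of $\dot x=g(t,x)$, $x(0)=x_0$, on $I_{g,x_0}$, and $x(\cdot,g,r,x_0)$ that of $\dot x=g(t,x)$, $x(r)=x_0$; $x(t,g,r,x_0)=x(t-r,g_r,x_0)$. For a topology $\mathcal T$ on $\mathrm{LC}$, $\mathrm{Hull}_{(\mathrm{LC},\mathcal T)}(f)$ is the closure of $\{f_t\mid t\in\mathbb R\}$; ''the induced local skew-product flow is continuous'' means the map $\Pi(t,g,x_0)=(g_t,x(t,g,x_0))$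 is defined and continuous on the open set $\{(t,g,x_0): g\in\mathrm{Hull}(f),\,t\in I_{g,x_0}\}$. $\mathbb A(f)$ (resp. $\mathbb O(f)$) is the set of $\mathcal T$-limits of $f_{t_n}$ with $t_n\downarrow-\infty$ (resp. $t_n\uparrow\infty$). When defined, the process of $g$ is $S_g(t,s)x_0=x(t,g,s,x_0)$, $t\ge s$. Solutions of $\dot x=g(t,x)$ are uniformly ultimately bounded if there is $c>0$ such that for every $d>0$ there is $T(d)>0$ with $|S_g(t+r,r)x_0|\le c$ for all $r\in\mathbb R$, $t\ge T(d)$, $|x_0|\le d$; they are uniformly ultimately bounded on $[\tau,\infty)$ if there is $c(\tau)>0$ such that for every $d>0$ there is $T(\tau,d)>0$ with $|S_g(t+r,r)x_0|\le c(\tau)$ whenever $r\ge\tau$, $t\ge T(\tau,d)$, $|x_0|\le d$. A pullback attractor of a process $S$ on $\mathbb R^N$ is a family $\{\mathcal A(t)\}_{t\in\mathbb R}$ of compact sets with $S(t,s)\mathcal A(s)=\mathcal A(t)$ for $t\ge s$, $\lim_{s\to-\infty}\mathrm{dist}(S(t,s)D,\mathcal A(t))=0$ for every bounded $D$ and $t$ (dist = Hausdorff semi-distance $\sup_{a}\inf_b|a-b|$), and minimal among closed families with this attraction property; it is bounded if $\bigcup_t\mathcal A(t)$ is bounded. *)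

(* Defs.v *)
From Stdlib Require Fin.
From Stdlib Require Import Reals Lra List.
Open Scope R_scope.

Definition vec (N : nat) := Fin.t N -> R.

Fixpoint fsum (n : nat) : (Fin.t n -> R) -> R :=
  match n return (Fin.t n -> R) -> R with
  | O => fun _ => 0
  | S m => fun v => v Fin.F1 + fsum m (fun i => v (Fin.FS i))
  end.

Definition vsub {N : nat} (x y : vec N) : vec N := fun i => x i - y i.
Definition vnorm {N : nat} (x : vec N) : R := sqrt (fsum N (fun i => (x i) ^ 2)).

Definition openV {N : nat} (U : vec N -> Prop) : Prop :=
  forall x, U x -> exists d, 0 < d /\ forall y, vnorm (vsub y x) < d -> U y.

Definition closedV {N : nat} (C : vec N -> Prop) : Prop :=
  openV (fun x => ~ C x).

Definition boundedV {N : nat} (A : vec N -> Prop) : Prop :=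
  exists B, forall x, A x -> vnorm x <= B.

Definition compactV {N : nat} (K : vec N -> Prop) : Prop :=
  forall (I : Type) (U : I -> vec N -> Prop),
    (forall i, openV (U i)) -> (forall x, K x -> exists i, U i x) ->
    exists l : list I, forall x, K x -> exists i, In i l /\ U i x.

Definition openP {N : nat} (O : R * vec N -> Prop) : Prop :=
  forall p, O p -> exists d, 0 < d /\ forall q,
      Rabs (fst q - fst p) < d -> vnorm (vsub (snd q) (snd p)) < d -> O q.

Inductive borel {N : nat} : (R * vec N -> Prop) -> Prop :=
| borel_open O : openP O -> borel O
| borel_compl A : borel A -> borel (fun p => ~ A p)
| borel_union (A : nat -> R * vec N -> Prop) :
    (forall n, borel (A n)) -> borel (fun p => exists n, A n p)
| borel_ext A B : borel A -> (forall p, A p <-> B p) -> borel B.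

Definition covers_with (A : R -> Prop) (r : R) : Prop :=
  exists a b : nat -> R,
    (forall n, a n <= b n) /\
    (forall t, A t -> exists n, a n < t < b n) /\
    (forall n, sum_f_R0 (fun k => b k - a k) n <= r).

Definition outer_le (A : R -> Prop) (r : R) : Prop :=
  forall eps, 0 < eps -> covers_with A (r + eps).

Definition outer_ge (A : R -> Prop) (r : R) : Prop :=
  forall r', outer_le A r' -> r <= r'.

Definition null (A : R -> Prop) : Prop := outer_le A 0.

Definition ae (P : R -> Prop) : Prop :=
  exists A, null A /\ forall t, ~ A t -> P t.

(* Lebesgue measurability (Caratheodory criterion) *)
Definition leb_meas (E : R -> Prop) : Prop :=
  forall X r, outer_le X r -> exists r1 r2,
    outer_le (fun t => X t /\ E t) r1 /\ outer_le (fun t => X t /\ ~ E t) r2 /\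
    r1 + r2 <= r.

Definition leb_meas_fun (m : R -> R) : Prop :=
  forall c, leb_meas (fun t => c < m t).

(* the Lebesgue integral of |m| over [a,b] is finite: the integrals of the
   nonnegative simple functions below |m| 1_[a,b] are bounded *)
Definition int_abs_finite (m : R -> R) (a b : R) : Prop :=
  exists B, forall (n : nat) (E : nat -> R -> Prop) (c r : nat -> R),
    (forall i, (i <= n)%nat -> leb_meas (E i)) ->
    (forall i j t, (i <= n)%nat -> (j <= n)%nat -> i <> j -> E i t -> E j t -> False) ->
    (forall i t, (i <= n)%nat -> E i t -> a <= t <= b /\ c i <= Rabs (m t)) ->
    (forall i, (i <= n)%nat -> 0 <= c i /\ outer_ge (E i) (r i)) ->
    sum_f_R0 (fun i => c i * r i) n <= B.

Definition L1loc (m : R -> R) : Prop :=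
  leb_meas_fun m /\ forall a b, a <= b -> int_abs_finite m a b.

Definition LCF (N : nat) := R -> vec N -> vec N.

Definition LC {N : nat} (f : LCF N) : Prop :=
  (forall U, openV U -> borel (fun p : R * vec N => U (f (fst p) (snd p)))) /\
  forall K : vec N -> Prop, compactV K ->
    exists m l : R -> R, L1loc m /\ L1loc l /\
      ae (fun t => forall x y, K x -> K y ->
            vnorm (f t x) <= m t /\
            vnorm (vsub (f t x) (f t y)) <= l t * vnorm (vsub x y)).

Definition shift {N : nat} (f : LCF N) (t : R) : LCF N := fun s x => f (s + t) x.

Definition interval (J : R -> Prop) : Prop :=
  forall a b c, J a -> J c -> a <= b <= c -> J b.

Definition AC {N : nat} (x : R -> vec N) (a b : R) : Prop :=
  forall eps, 0 < eps -> exists del, 0 < del /\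
    forall (n : nat) (u w : nat -> R),
      (forall k, (k <= n)%nat -> a <= u k /\ u k <= w k /\ w k <= b) ->
      (forall k, (k < n)%nat -> w k <= u (S k)) ->
      sum_f_R0 (fun k => w k - u k) n < del ->
      sum_f_R0 (fun k => vnorm (vsub (x (w k)) (x (u k)))) n < eps.

Definition sol {N : nat} (g : LCF N) (s : R) (x0 : vec N) (J : R -> Prop)
  (x : R -> vec N) : Prop :=
  interval J /\ J s /\ x s = x0 /\
  (forall a b, J a -> J b -> a <= b -> AC x a b) /\
  ae (fun t => J t -> forall i, derivable_pt_lim (fun u => x u i) t (g t (x t) i)).

(* v = x(t, g, s, x0) (t in the maximal interval of existence) *)
Definition sol_val {N : nat} (g : LCF N) (s : R) (x0 : vec N) (t : R) (v : vec N) : Prop :=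
  exists J x, sol g s x0 J x /\ J t /\ x t = v.

Definition topology_on {N : nat} (T : (LCF N -> Prop) -> Prop) : Prop :=
  T (fun g => LC g) /\ T (fun _ => False) /\
  (forall U, T U -> forall g, U g -> LC g) /\
  (forall U V, T U -> T V -> T (fun g => U g /\ V g)) /\
  (forall F : (LCF N -> Prop) -> Prop, (forall U, F U -> T U) ->
     T (fun g => exists U, F U /\ U g)).

Definition Hull {N : nat} (T : (LCF N -> Prop) -> Prop) (f g : LCF N) : Prop :=
  LC g /\ forall U, T U -> U g -> exists t, U (shift f t).

Definition conv {N : nat} (T : (LCF N -> Prop) -> Prop) (gs : nat -> LCF N) (g : LCF N) : Prop :=
  forall U, T U -> U g -> exists n0, forall n, (n0 <= n)%nat -> U (gs n).

Definition Omega {N : nat} (T : (LCF N -> Prop) -> Prop) (f g : LCF N) : Prop :=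
  LC g /\ exists tn : nat -> R,
    (forall n, tn n <= tn (S n)) /\ (forall M, exists n, M < tn n) /\
    conv T (fun n => shift f (tn n)) g.

Definition skew_dom {N : nat} (T : (LCF N -> Prop) -> Prop) (f : LCF N)
  (t : R) (g : LCF N) (x0 : vec N) : Prop :=
  Hull T f g /\ exists v, sol_val g 0 x0 t v.

(* Pi(t,g,x0) = (g_t, x(t,g,x0)) is defined (values in Hull x R^N) and
   continuous on its domain, which is open in R x Hull x R^N *)
Definition skew_cont {N : nat} (T : (LCF N -> Prop) -> Prop) (f : LCF N) : Prop :=
  (forall t g x0, skew_dom T f t g x0 -> Hull T f (shift g t)) /\
  (forall t g x0, skew_dom T f t g x0 -> exists d V, 0 < d /\ T V /\ V g /\
     forall t' g' x0', Rabs (t' - t) < d -> V g' -> Hull T f g' ->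
       vnorm (vsub x0' x0) < d -> skew_dom T f t' g' x0') /\
  (forall t g x0, skew_dom T f t g x0 ->
     forall U eps, T U -> U (shift g t) -> 0 < eps ->
     exists d V, 0 < d /\ T V /\ V g /\
     forall t' g' x0', Rabs (t' - t) < d -> V g' -> Hull T f g' ->
       vnorm (vsub x0' x0) < d -> skew_dom T f t' g' x0' ->
       U (shift g' t') /\
       forall v v', sol_val g 0 x0 t v -> sol_val g' 0 x0' t' v' ->
         vnorm (vsub v' v) < eps).

Definition process_defined {N : nat} (g : LCF N) : Prop :=
  forall s x0, exists x, sol g s x0 (fun t => s <= t) x.

Definition UUB {N : nat} (g : LCF N) : Prop :=
  exists c, 0 < c /\ forall d, 0 < d -> exists T, 0 < T /\
    forall r t x0 v, T <= t -> vnorm x0 <= d ->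
      sol_val g r x0 (t + r) v -> vnorm v <= c.

Definition UUB_on {N : nat} (g : LCF N) (tau : R) : Prop :=
  exists c, 0 < c /\ forall d, 0 < d -> exists T, 0 < T /\
    forall r t x0 v, tau <= r -> T <= t -> vnorm x0 <= d ->
      sol_val g r x0 (t + r) v -> vnorm v <= c.

Definition pullback_attracts {N : nat} (g : LCF N) (C : R -> vec N -> Prop) : Prop :=
  forall (D : vec N -> Prop) (t : R), boundedV D ->
    forall eps, 0 < eps -> exists s0, s0 <= t /\
      forall s x0 y, s <= s0 -> D x0 -> sol_val g s x0 t y ->
        exists a, C t a /\ vnorm (vsub y a) <= eps.

Definition pullback_attractor {N : nat} (g : LCF N) (A : R -> vec N -> Prop) : Prop :=
  (forall t, compactV (A t)) /\
  (forall t s, s <= t -> forall y,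
     A t y <-> exists x0, A s x0 /\ sol_val g s x0 t y) /\
  pullback_attracts g A /\
  (forall C : R -> vec N -> Prop, (forall t, closedV (C t)) ->
     pullback_attracts g C -> forall t y, A t y -> C t y).

Definition bounded_family {N : nat} (A : R -> vec N -> Prop) : Prop :=
  exists B, forall t y, A t y -> vnorm y <= B.

(* Main.v *)
(** Continuity of the skew-product flow at a point of its open domain yields uniqueness and local
    existence for every equation of the hull. Let [f_{t_n} -> g]. Ultimate boundedness passes from
    [f] to [g], with the same bound, by continuity in the first variable, provided that every
    translate of [g] lies again in the omega-limit set. This is clear for forward translates. For a
    backward translate by [L] one needs a solution of [g] on [[-L, 0]]: take a cluster point [y] of
    the values at 0 of solutions of [f_{t_n}] started so early that they obey the ultimate bound
    on [[-L, 0]]. The backward solution of [g] through [y] then stays in a ball, so its speed is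
    at most some [m] in [L1loc] and it cannot stop before [-L]. The pullback attractor is the
    pullback omega-limit set of the absorbing ball. *)

Require Import Defs.
From Stdlib Require Fin FinFun Cantor.
From Stdlib Require Import Reals Lra Lia List Arith Classical ClassicalEpsilon FunctionalExtensionality.
Open Scope R_scope.

(** * Euclidean space *)

(** [T] is an arbitrary topology, so translation by a fixed time is not known to be continuous on
    the hull. The only source of [f_{t_n + t} -> g_t] is the first component of the flow at a point
    [(t, g, x0)] of its domain; this is why a backward translate of [g] calls for a solution that
    exists back to that time. The set of backward times reached is closed by the [L1loc] bound on
    the speed, and open because the domain of the flow is open.

    Closedness requires a modulus of continuity from a bound [|x'| <= m] almost everywhere, while
    [L1loc] only bounds sums over simple functions below [|m|]. No integral of [m] is formed. The
    high level sets [j < m <= j + 1] are covered by open intervals, the lengths of these covers give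
    monotone functions that dominate the increments of [x] locally, and Cousin's lemma makes the
    domination global. On the null set where the derivative is not controlled, absolute continuity
    of [x] absorbs the increments. *)

Lemma fsum_nonneg N (v : vec N) : (forall i, 0 <= v i) -> 0 <= fsum N v.
Proof.
  induction N as [|N IH]; simpl; intros H; [lra|].
  specialize (IH (fun i => v (Fin.FS i)) (fun i => H _)).
  specialize (H Fin.F1). lra.
Qed.

Lemma fsum_sq_nonneg N (v : vec N) : 0 <= fsum N (fun i => v i ^ 2).
Proof. apply fsum_nonneg. intros i. apply pow2_ge_0. Qed.

Lemma vnorm_nonneg {N} (x : vec N) : 0 <= vnorm x.
Proof. apply sqrt_pos. Qed.

Lemma vnorm_sq {N} (x : vec N) : vnorm x ^ 2 = fsum N (fun i => x i ^ 2).
Proof. unfold vnorm. rewrite pow2_sqrt; auto using fsum_sq_nonneg. Qed.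

Lemma vnorm_sq_S {N} (x : vec (S N)) :
  vnorm x ^ 2 = x Fin.F1 ^ 2 + vnorm (fun i => x (Fin.FS i)) ^ 2.
Proof. rewrite !vnorm_sq. reflexivity. Qed.

Lemma le_of_sq (a b : R) : 0 <= b -> a ^ 2 <= b ^ 2 -> a <= b.
Proof. intros. destruct (Rle_dec a b); [easy|nra]. Qed.

(** Minkowski's inequality by induction on the dimension: splitting off the first coordinate reduces
    each step to vectors of the plane. *)
Lemma vnorm_add {N} (x y : vec N) :
  vnorm (fun i => x i + y i) <= vnorm x + vnorm y.
Proof.
  induction N as [|N IH].
  - unfold vnorm; simpl. rewrite sqrt_0. lra.
  - apply le_of_sq.
    + pose proof (vnorm_nonneg x); pose proof (vnorm_nonneg y); lra.
    + specialize (IH (fun i => x (Fin.FS i)) (fun i => y (Fin.FS i))).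
      rewrite vnorm_sq_S.
      pose proof (vnorm_sq_S x) as Hx. pose proof (vnorm_sq_S y) as Hy.
      pose proof (vnorm_nonneg x). pose proof (vnorm_nonneg y).
      pose proof (vnorm_nonneg (fun i => x (Fin.FS i))).
      pose proof (vnorm_nonneg (fun i => y (Fin.FS i))).
      pose proof (vnorm_nonneg (fun i => x (Fin.FS i) + y (Fin.FS i))).
      set (p := vnorm (fun i => x (Fin.FS i))) in *.
      set (q := vnorm (fun i => y (Fin.FS i))) in *.
      set (s := vnorm (fun i => x (Fin.FS i) + y (Fin.FS i))) in *.
      set (a := x Fin.F1) in *. set (b := y Fin.F1) in *.
      set (X := vnorm x) in *. set (Y := vnorm y) in *.
      (* Cauchy-Schwarz for the plane vectors [(a, p)] and [(b, q)]: the squares of the two sides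
         differ by [(a q - b p)^2]. *)
      assert (a * b + p * q <= X * Y).
      { apply le_of_sq; [nra|].
        replace ((X * Y) ^ 2) with (X ^ 2 * Y ^ 2) by ring. rewrite Hx, Hy.
        pose proof (pow2_ge_0 (a * q - b * p)). nra. }
      assert (s ^ 2 <= (p + q) ^ 2) by (apply pow_incr; lra).
      nra.
Qed.

Lemma vnorm_scal {N} (c : R) (x : vec N) :
  vnorm (fun i => c * x i) = Rabs c * vnorm x.
Proof.
  induction N as [|N IH].
  - unfold vnorm; simpl. rewrite sqrt_0. ring.
  - assert (H : vnorm (fun i => c * x i) ^ 2 = (Rabs c * vnorm x) ^ 2).
    { rewrite vnorm_sq_S, (IH (fun i => x (Fin.FS i))), !Rpow_mult_distr, pow2_abs,
        (vnorm_sq_S x). ring. }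
    apply Rle_antisym; (apply le_of_sq;
      [try apply Rmult_le_pos; auto using vnorm_nonneg, Rabs_pos|lra]).
Qed.

Lemma vnorm_coord {N} (x : vec N) i : Rabs (x i) <= vnorm x.
Proof.
  revert x. induction i as [N|N i IH]; intros x.
  - apply le_of_sq; [apply vnorm_nonneg|].
    rewrite pow2_abs, vnorm_sq_S. pose proof (pow2_ge_0 (vnorm (fun i => x (Fin.FS i)))). lra.
  - eapply Rle_trans; [apply (IH (fun i => x (Fin.FS i)))|].
    apply le_of_sq; [apply vnorm_nonneg|].
    rewrite vnorm_sq_S. pose proof (pow2_ge_0 (x Fin.F1)). lra.
Qed.

Lemma vnorm_S_le {N} (x : vec (S N)) :
  vnorm x <= Rabs (x Fin.F1) + vnorm (fun i => x (Fin.FS i)).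
Proof.
  pose proof (Rabs_pos (x Fin.F1)). pose proof (vnorm_nonneg (fun i => x (Fin.FS i))).
  apply le_of_sq; [lra|]. rewrite vnorm_sq_S, <- (pow2_abs (x Fin.F1)). nra.
Qed.

Lemma vnorm_le_coords {N} (x : vec N) e :
  0 <= e -> (forall i, Rabs (x i) <= e) -> vnorm x <= INR N * e.
Proof.
  intros He. induction N as [|N IH]; intros H.
  - unfold vnorm; simpl. rewrite sqrt_0. lra.
  - eapply Rle_trans; [apply vnorm_S_le|].
    specialize (IH (fun i => x (Fin.FS i)) (fun i => H _)). specialize (H Fin.F1).
    rewrite S_INR. lra.
Qed.

Lemma vnorm_sub_sym {N} (x y : vec N) : vnorm (vsub x y) = vnorm (vsub y x).
Proof.
  replace (vsub x y) with (fun i => (-1) * vsub y x i).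
  - rewrite vnorm_scal. rewrite (Rabs_left (-1)) by lra. ring.
  - apply functional_extensionality; intros i. unfold vsub; ring.
Qed.

Lemma vnorm_sub_triangle {N} (y x z : vec N) :
  vnorm (vsub x z) <= vnorm (vsub x y) + vnorm (vsub y z).
Proof.
  replace (vsub x z) with (fun i => vsub x y i + vsub y z i); [apply vnorm_add|].
  apply functional_extensionality; intros i. unfold vsub; ring.
Qed.

Lemma vnorm_le_sub {N} (x y : vec N) : vnorm x <= vnorm y + vnorm (vsub x y).
Proof.
  replace x with (fun i => y i + vsub x y i) at 1; [apply vnorm_add|].
  apply functional_extensionality; intros i. unfold vsub; ring.
Qed.

Lemma vnorm_zero {N} : vnorm (fun _ : Fin.t N => 0) = 0.
Proof.
  apply Rle_antisym; [|apply vnorm_nonneg].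
  rewrite <- (Rmult_0_r (INR N)).
  apply vnorm_le_coords; [lra|]. intros i. rewrite Rmult_0_r, Rabs_R0. lra.
Qed.

Lemma vnorm_sub_self {N} (x : vec N) : vnorm (vsub x x) = 0.
Proof.
  rewrite <- (@vnorm_zero N). f_equal.
  apply functional_extensionality; intros i. unfold vsub; ring.
Qed.

Lemma vnorm_sub_eq {N} (x y : vec N) :
  (forall eps, 0 < eps -> vnorm (vsub x y) < eps) -> x = y.
Proof.
  intros H. apply functional_extensionality; intros i.
  destruct (Req_dec (x i) (y i)) as [|n]; [easy|exfalso].
  assert (0 < Rabs (x i - y i)) by (apply Rabs_pos_lt; lra).
  specialize (H _ H0). pose proof (vnorm_coord (vsub x y) i) as Hi.
  unfold vsub at 1 in Hi. lra.
Qed.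

(** * Uniform radii, finite covers and compactness *)

Lemma fin_uniform_radius N (P : Fin.t N -> R -> Prop) :
  (forall i r r', r' <= r -> P i r -> P i r') ->
  (forall i, exists r, 0 < r /\ P i r) -> exists r, 0 < r /\ forall i, P i r.
Proof.
  induction N as [|N IH]; intros Hm H.
  - exists 1. split; [lra|]. intros i. apply (Fin.case0 (fun i => P i 1)).
  - destruct (IH (fun i => P (Fin.FS i))) as [r [Hr Hr']]; eauto.
    destruct (H Fin.F1) as [r1 [Hr1 H1]].
    exists (Rmin r r1). split; [apply Rmin_glb_lt; auto|].
    intros i. apply (Fin.caseS' i (fun i => P i (Rmin r r1))).
    + eapply Hm; [apply Rmin_r|easy].
    + intros j. eapply Hm; [apply Rmin_l|easy].
Qed.

(* Cousin's lemma, phrased as an induction principle for additive interval predicates. *)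
Lemma interval_induction (P : R -> R -> Prop) (u w : R) :
  u <= w ->
  (forall a b c, u <= a -> a <= b -> b <= c -> c <= w -> P a b -> P b c -> P a c) ->
  (forall t, u <= t <= w -> exists d, 0 < d /\ forall a b,
     t - d < a -> a <= t -> t <= b -> b < t + d -> u <= a -> b <= w -> P a b) ->
  P u w.
Proof.
  intros Huw Hadd Hloc.
  set (E := fun t => u <= t <= w /\ P u t).
  assert (Eu : E u).
  { split; [lra|]. destruct (Hloc u) as [d [Hd H]]; [lra|]. apply H; lra. }
  destruct (completeness E) as [s [Hub Hlub]].
  { exists w. intros t [Ht _]. lra. }
  { exists u. exact Eu. }
  assert (Hus : u <= s) by (apply Hub; exact Eu).
  assert (Hsw : s <= w) by (apply Hlub; intros t [Ht _]; lra).
  destruct (Hloc s) as [d [Hd H]]; [lra|].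
  assert (Hex : exists t, E t /\ s - d < t).
  { apply NNPP. intros Hn. assert (s <= s - d); [|lra].
    apply Hlub. intros t Et. destruct (Rle_dec t (s - d)); [easy|].
    exfalso; apply Hn; exists t; split; [easy|lra]. }
  destruct Hex as [t [Et Hst]].
  assert (t <= s) by (apply Hub; exact Et).
  destruct Et as [Ht HP].
  (* The point [b], beyond [s] unless [w] comes first, still belongs to [E]; hence [b <= s], which
     leaves only [b = w]. *)
  set (b := Rmin w (s + d / 2)).
  assert (Hb1 : b <= w) by apply Rmin_l.
  assert (Hb2 : b <= s + d / 2) by apply Rmin_r.
  assert (Hb3 : s <= b) by (apply Rmin_glb; lra).
  assert (Eb : E b).
  { split; [lra|]. apply Hadd with t; try lra; [easy|]. apply H; lra. }
  assert (b <= s) by (apply Hub; exact Eb).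
  assert (b = w).
  { unfold b in *. unfold Rmin in *. destruct (Rle_dec w (s + d / 2)); lra. }
  destruct Eb as [_ HPb]. now rewrite <- H2.
Qed.

(** Induction on the dimension, with Cousin's lemma along the first coordinate: a finite subcover of
    one slice also covers a slab around it, and slabs are joined by appending lists. *)
Lemma cube_finite_cover N c (I : Type) (U : I -> vec N -> Prop) :
  (forall i, openV (U i)) ->
  (forall x, (forall k, Rabs (x k) <= c) -> exists i, U i x) ->
  exists l : list I, forall x, (forall k, Rabs (x k) <= c) -> exists i, In i l /\ U i x.
Proof.
  revert I U. induction N as [|N IH]; intros I U HO HC.
  - destruct (HC (fun _ => 0)) as [i Hi].
    { intros k. apply (Fin.case0 (fun k => Rabs 0 <= c) k). }
    exists (i :: nil). intros x _. exists i. split; [now left|].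
    replace x with (fun _ : Fin.t 0 => 0); [easy|].
    apply functional_extensionality; intros k.
    apply (Fin.case0 (fun k => 0 = x k) k).
  - destruct (Rle_dec 0 c) as [Hc|Hc].
    2:{ exists nil. intros x Hx. specialize (Hx Fin.F1).
        pose proof (Rabs_pos (x Fin.F1)). lra. }
    set (tl := fun (x : vec (S N)) => (fun k => x (Fin.FS k)) : vec N).
    set (cons := fun (h : R) (v : vec N) =>
                   (fun k => Fin.caseS' k (fun _ => R) h v) : vec (S N)).
    assert (Hcons : forall x, x = cons (x Fin.F1) (tl x)).
    { intros x. apply functional_extensionality; intros k.
      now apply (Fin.caseS' k (fun k => x k = cons (x Fin.F1) (tl x) k)). }
    set (P := fun a b => exists l : list I, forall x : vec (S N), a <= x Fin.F1 <= b ->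
                (forall k, Rabs (tl x k) <= c) -> exists i, In i l /\ U i x).
    assert (HP : P (- c) c).
    { apply interval_induction; [lra| |].
      - intros a b d _ _ _ _ [l1 H1] [l2 H2]. exists (l1 ++ l2). intros x Hx Ht.
        destruct (Rle_dec (x Fin.F1) b).
        + destruct (H1 x) as [i [Hi Ui]]; [lra|easy|].
          exists i; split; [apply in_or_app; now left|easy].
        + destruct (H2 x) as [i [Hi Ui]]; [lra|easy|].
          exists i; split; [apply in_or_app; now right|easy].
      - intros h Hh.
        (* Tube lemma. A pair of a set and a radius [d] accepts [w] when the set contains a
           neighbourhood of [w] at all heights within [d] of [h]. The radius is part of the index so
           that finitely many radii can be compared afterwards. *)
        destruct (IH (I * R)%type (fun q w => 0 < snd q /\ exists e, 0 < e /\
            forall h' w', Rabs (h' - h) < snd q -> vnorm (vsub w' w) < e ->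
              U (fst q) (cons h' w'))) as [l Hl].
        + intros [i d] w [Hd [e [He H]]]. exists (e / 2). split; [lra|].
          intros y Hy. split; [easy|]. exists (e / 2). split; [lra|].
          intros h' w' Hh' Hw'. apply H; [easy|].
          pose proof (vnorm_sub_triangle y w' w). lra.
        + intros w Hw. destruct (HC (cons h w)) as [i Hi].
          { intros k. apply (Fin.caseS' k (fun k => Rabs (cons h w k) <= c)); simpl.
            - apply Rabs_le; lra.
            - exact Hw. }
          destruct (HO i _ Hi) as [d [Hd H]].
          exists (i, d / 2). split; [simpl; lra|]. exists (d / 2). split; [lra|].
          simpl. intros h' w' H1 H2. apply H.
          eapply Rle_lt_trans; [apply vnorm_S_le|]. unfold vsub in *. simpl. lra.
        (* Pairs with a nonpositive radius accept no point, so only positive radii enter the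
           minimum. *)
        + assert (Hd : exists d, 0 < d /\ forall q, In q l -> 0 < snd q -> d <= snd q).
          { clear. induction l as [|[i e] l [d [Hd H]]].
            - exists 1. split; [lra|]. intros q [].
            - destruct (Rlt_dec 0 e).
              + exists (Rmin d e). split; [now apply Rmin_glb_lt|].
                intros q [<-|Hq] Hp; [apply Rmin_r|].
                eapply Rle_trans; [apply Rmin_l|auto].
              + exists d. split; [easy|]. intros q [<-|Hq] Hp; simpl in *; [lra|auto]. }
          destruct Hd as [d [Hd H]]. exists d. split; [easy|].
          intros a b Ha1 Ha2 Hb1 Hb2 _ _. exists (map fst l). intros x Hx Ht.
          destruct (Hl (tl x) Ht) as [q [Hq [Hq1 [e [He Hq2]]]]].
          exists (fst q). split; [now apply in_map|].
          rewrite (Hcons x). specialize (H q Hq Hq1). apply Hq2.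
          * apply Rabs_def1; lra.
          * now rewrite vnorm_sub_self. }
    destruct HP as [l Hl]. exists l. intros x Hx. apply Hl.
    + specialize (Hx Fin.F1). split; unfold Rabs in Hx; destruct (Rcase_abs _) in Hx; lra.
    + intros k. apply Hx.
Qed.

(** The complement of [K] joins the cover under the index [None], so that a whole cube is covered;
    [flat_map] then drops that index, which holds no point of [K]. *)
Lemma compact_closed_bounded {N} (K : vec N -> Prop) :
  closedV K -> boundedV K -> compactV K.
Proof.
  intros HK [B HB] I U HO HC.
  destruct (cube_finite_cover N B (option I)
    (fun o => match o with Some i => U i | None => fun x => ~ K x end)) as [l Hl].
  - intros [i|]; [apply HO|apply HK].
  - intros x _. destruct (classic (K x)) as [H|H].
    + destruct (HC x H) as [i Hi]. now exists (Some i).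
    + now exists None.
  - exists (flat_map (fun o => match o with Some i => i :: nil | None => nil end) l).
    intros x Hx. destruct (Hl x) as [[i|] [Hi Ui]].
    + intros k. eapply Rle_trans; [apply vnorm_coord|auto].
    + exists i. split; [|easy]. apply in_flat_map. exists (Some i). split; [easy|now left].
    + easy.
Qed.

Definition ball {N} (c : R) (x : vec N) : Prop := vnorm x <= c.

Lemma compact_ball {N} c : compactV (@ball N c).
Proof.
  apply compact_closed_bounded; [|now exists c].
  intros x Hx. unfold ball in *. exists (vnorm x - c). split; [lra|]. intros y Hy Hn.
  pose proof (vnorm_le_sub x y). rewrite vnorm_sub_sym in Hy. lra.
Qed.

(** Without a cluster point, every point has a neighbourhood that the sequence avoids from some
    index on. Finitely many of these cover the ball, and past the largest index the sequence would
    avoid all of them. *)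
Lemma bounded_seq_cluster {N} (y : nat -> vec N) c n0 :
  (forall n, (n0 <= n)%nat -> vnorm (y n) <= c) ->
  exists z, forall eps n1, 0 < eps -> exists n, (n1 <= n)%nat /\ vnorm (vsub (y n) z) < eps.
Proof.
  intros Hy. apply NNPP. intros Hn.
  destruct (@compact_ball N c (vec N * R * nat)%type
    (fun q w => vnorm (vsub w (fst (fst q))) < snd (fst q) /\
       forall n, (snd q <= n)%nat -> ~ vnorm (vsub (y n) (fst (fst q))) < snd (fst q)))
    as [l Hl].
  - intros [[z e] n1] w [H1 H2]. simpl in *.
    exists (e - vnorm (vsub w z)). split; [lra|]. intros v Hv. split; [|easy].
    pose proof (vnorm_sub_triangle w v z). lra.
  - intros z _. apply NNPP. intros H. apply Hn. exists z. intros eps n1 He.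
    apply NNPP. intros H'. apply H. exists (z, eps, n1). simpl. split.
    + rewrite vnorm_sub_self. lra.
    + intros n Hle Hlt. apply H'. now exists n.
  (* Starting the maximum at [n0] keeps [y M] inside the ball. *)
  - set (M := fold_right (fun q => Nat.max (snd q)) n0 l).
    assert (HM : (n0 <= M)%nat /\ forall q, In q l -> (snd q <= M)%nat).
    { unfold M. clear. induction l as [|q l [IH1 IH2]]; simpl.
      - split; [lia|easy].
      - split; [lia|]. intros q' [<-|H]; [lia|]. specialize (IH2 _ H). lia. }
    destruct HM as [HM1 HM2].
    destruct (Hl (y M) (Hy M HM1)) as [q [Hq [H1 H2]]].
    exact (H2 M (HM2 q Hq) H1).
Qed.

(** * Choice functions and finite sums *)

Lemma choice_fun {A B : Type} (P : A -> B -> Prop) :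
  (forall x, exists y, P x y) -> exists F : A -> B, forall x, P x (F x).
Proof.
  intros H. exists (fun x => proj1_sig (constructive_indefinite_description _ (H x))).
  intros x. apply proj2_sig.
Qed.

(** List sums can be empty, concatenated and compared through inclusion, which suits both the
    reindexing of double sums and the chains of intervals below. *)
Definition lsum {A : Type} (F : A -> R) (l : list A) : R :=
  fold_right (fun q s => F q + s) 0 l.

Lemma lsum_app {A} (F : A -> R) l1 l2 : lsum F (l1 ++ l2) = lsum F l1 + lsum F l2.
Proof. induction l1 as [|q l IH]; simpl; [ring|]. rewrite IH. ring. Qed.

Lemma lsum_map {A B} (h : A -> B) (F : B -> R) l : lsum F (map h l) = lsum (fun x => F (h x)) l.
Proof. induction l as [|q l IH]; simpl; congruence. Qed.

Lemma lsum_prod {A B} (F : A * B -> R) l1 l2 :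
  lsum F (list_prod l1 l2) = lsum (fun x => lsum (fun y => F (x, y)) l2) l1.
Proof.
  induction l1 as [|q l IH]; simpl; [easy|]. now rewrite lsum_app, lsum_map, IH.
Qed.

Lemma lsum_nonneg {A} (F : A -> R) l : (forall x, 0 <= F x) -> 0 <= lsum F l.
Proof. intros H. induction l as [|q l IH]; simpl; [lra|]. specialize (H q). lra. Qed.

Lemma lsum_incl {A} (F : A -> R) l l' :
  (forall x, 0 <= F x) -> NoDup l -> incl l l' -> lsum F l <= lsum F l'.
Proof.
  intros HF. revert l'. induction l as [|q l IH]; simpl; intros l' Hd Hi.
  - now apply lsum_nonneg.
  - inversion_clear Hd.
    destruct (in_split q l') as [l1 [l2 ->]]; [apply Hi; now left|].
    rewrite lsum_app. simpl.
    assert (lsum F l <= lsum F (l1 ++ l2)); [|rewrite lsum_app in *; lra].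
    apply IH; [easy|]. intros z Hz. specialize (Hi z (or_intror Hz)).
    apply in_app_or in Hi. apply in_or_app. destruct Hi as [Hi|[<-|Hi]]; [now left|easy|now right].
Qed.

Lemma sum_f_R0_lsum F n : sum_f_R0 F n = lsum F (seq 0 (S n)).
Proof.
  induction n as [|n IH]; [simpl; ring|].
  rewrite seq_S, lsum_app, <- IH. simpl. ring.
Qed.

(** Both components of a pair are at most its Cantor code, so the first [n + 1] pairs are distinct
    points of the square on the right. *)
Lemma cantor_sum_le (F : nat * nat -> R) n :
  (forall q, 0 <= F q) ->
  sum_f_R0 (fun i => F (Cantor.of_nat i)) n <=
  sum_f_R0 (fun k => sum_f_R0 (fun l => F (k, l)) n) n.
Proof.
  intros HF. rewrite !sum_f_R0_lsum.
  rewrite <- (lsum_map Cantor.of_nat F).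
  replace (fun k => sum_f_R0 (fun l => F (k, l)) n)
    with (fun k => lsum (fun l => F (k, l)) (seq 0 (S n))).
  2:{ apply functional_extensionality; intros k. now rewrite sum_f_R0_lsum. }
  rewrite <- (lsum_prod F). apply lsum_incl; [easy| |].
  - apply FinFun.Injective_map_NoDup; [|apply seq_NoDup].
    intros i j H. rewrite <- (Cantor.cancel_to_of i), <- (Cantor.cancel_to_of j). congruence.
  - intros [k l] Hq. apply in_map_iff in Hq. destruct Hq as [i [Hi Hin]].
    apply in_seq in Hin.
    pose proof (Cantor.to_nat_non_decreasing k l) as Hle.
    rewrite <- Hi, Cantor.cancel_to_of in Hle.
    apply in_prod; apply in_seq; lia.
Qed.

Lemma sum_half n : sum_f_R0 (fun k => (/ 2) ^ k) n <= 2.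
Proof.
  assert (H : sum_f_R0 (fun k => (/ 2) ^ k) n = 2 - (/ 2) ^ n).
  { induction n as [|n IH]; simpl; [lra|]. rewrite IH. lra. }
  rewrite H. assert (0 < (/ 2) ^ n) by (apply pow_lt; lra). lra.
Qed.

Lemma sum_term_le (F : nat -> R) j n :
  (forall i, 0 <= F i) -> (j <= n)%nat -> F j <= sum_f_R0 F n.
Proof.
  intros HF Hj. induction n as [|n IH]; simpl.
  - replace j with 0%nat by lia. lra.
  - destruct (Nat.eq_dec j (S n)) as [->|].
    + pose proof (cond_pos_sum F n HF). lra.
    + specialize (HF (S n)). assert (F j <= sum_f_R0 F n) by (apply IH; lia). lra.
Qed.

Lemma sum_le_mono (F : nat -> R) n m :
  (forall i, 0 <= F i) -> (n <= m)%nat -> sum_f_R0 F n <= sum_f_R0 F m.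
Proof.
  intros HF H. induction H; simpl; [lra|]. specialize (HF (S m)). lra.
Qed.

(** * Lebesgue outer measure *)

Lemma covers_nonneg A r : covers_with A r -> 0 <= r.
Proof. intros (a & b & H1 & _ & H3). specialize (H1 0%nat). specialize (H3 0%nat). simpl in H3. lra. Qed.

Lemma covers_weaken (A B : R -> Prop) r r' :
  (forall t, B t -> A t) -> r <= r' -> covers_with A r -> covers_with B r'.
Proof.
  intros HAB Hr (a & b & H1 & H2 & H3). exists a, b. split; [easy|].
  split; [intros t Ht; apply H2; auto|].
  intros n. specialize (H3 n). lra.
Qed.

Lemma covers_outer_le A r : covers_with A r -> outer_le A r.
Proof. intros H e He. apply covers_weaken with A r; [easy|lra|easy]. Qed.

Lemma outer_le_subset (A B : R -> Prop) r :
  (forall t, B t -> A t) -> outer_le A r -> outer_le B r.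
Proof. intros HAB H e He. apply covers_weaken with A (r + e); [easy|lra|auto]. Qed.

Lemma outer_le_nonneg A r : outer_le A r -> 0 <= r.
Proof.
  intros H. apply le_epsilon. intros e He. exact (covers_nonneg _ _ (H e He)).
Qed.

Lemma covers_empty (A : R -> Prop) : (forall t, ~ A t) -> covers_with A 0.
Proof.
  intros HA. exists (fun _ => 0), (fun _ => 0). split; [intros; lra|].
  split; [intros t Ht; now destruct (HA t)|]. intros n.
  rewrite (sum_eq _ (fun _ => 0)) by (intros; ring). rewrite sum_eq_R0; [lra|easy].
Qed.

(** Countable subadditivity: the intervals of all covers are enumerated by Cantor pairs, and every
    partial sum is bounded by a finite square block, so no series has to be rearranged. *)
Lemma covers_union (A : nat -> R -> Prop) (r : nat -> R) s :
  (forall n, covers_with (A n) (r n)) -> (forall n, sum_f_R0 r n <= s) ->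
  covers_with (fun t => exists n, A n t) s.
Proof.
  intros HA Hs.
  destruct (choice_fun _ HA) as [a Ha]. destruct (choice_fun _ Ha) as [b Hb].
  exists (fun i => a (fst (Cantor.of_nat i)) (snd (Cantor.of_nat i))),
         (fun i => b (fst (Cantor.of_nat i)) (snd (Cantor.of_nat i))).
  split; [|split].
  - intros i. apply Hb.
  - intros t [n Hn]. destruct (proj1 (proj2 (Hb n)) t Hn) as [k Hk].
    exists (Cantor.to_nat (n, k)). now rewrite Cantor.cancel_of_to.
  - intros n. eapply Rle_trans.
    + apply (cantor_sum_le (fun q => b (fst q) (snd q) - a (fst q) (snd q))).
      intros [k l]. simpl. pose proof (proj1 (Hb k) l). lra.
    + eapply Rle_trans; [|apply (Hs n)]. apply sum_Rle. intros k _. simpl. apply Hb.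
Qed.

Lemma outer_le_union A B r s :
  outer_le A r -> outer_le B s -> outer_le (fun t => A t \/ B t) (r + s).
Proof.
  intros HA HB e He.
  assert (HA' := HA (e / 2)). assert (HB' := HB (e / 2)).
  apply covers_weaken with (r := r + s + e)
    (A := fun t => exists n : nat, match n with 0%nat => A t | 1%nat => B t | _ => False end).
  - intros t [H|H]; [now exists 0%nat|now exists 1%nat].
  - lra.
  - apply covers_union with
      (r := fun n => match n with 0%nat => r + e / 2 | 1%nat => s + e / 2 | _ => 0 end).
    + intros [|[|n]]; [apply HA'; lra|apply HB'; lra|apply covers_empty; easy].
    + pose proof (outer_le_nonneg _ _ HB).
      intros [|n]; [simpl; lra|].
      induction n as [|n IH]; [simpl; lra|]. rewrite tech5. cbv beta iota. lra.
Qed.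

Lemma null_union (A : nat -> R -> Prop) :
  (forall n, null (A n)) -> null (fun t => exists n, A n t).
Proof.
  intros H e He. apply covers_union with (r := fun n => (/ 2) ^ n * (e / 2)).
  - intros n. eapply covers_weaken with (A := A n) (r := 0 + (/ 2) ^ n * (e / 2)); [easy|lra|].
    apply H. apply Rmult_lt_0_compat; [apply pow_lt; lra|lra].
  - intros n. rewrite <- (scal_sum (fun n => (/ 2) ^ n)). pose proof (sum_half n) as Hn.
    apply Rmult_le_compat_l with (r := e / 2) in Hn; lra.
Qed.

Lemma null_union2 A B : null A -> null B -> null (fun t => A t \/ B t).
Proof.
  intros HA HB. unfold null. replace 0 with (0 + 0) by ring. now apply outer_le_union.
Qed.

Lemma covers_interval (A : R -> Prop) a b :
  a <= b -> (forall t, A t -> a < t < b) -> covers_with A (b - a).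
Proof.
  intros Hab HA.
  exists (fun n => match n with 0%nat => a | _ => 0 end),
         (fun n => match n with 0%nat => b | _ => 0 end).
  split; [intros [|n]; lra|]. split; [intros t Ht; exists 0%nat; auto|].
  intros n. induction n as [|n IH]; [simpl; lra|]. rewrite tech5. cbv beta iota. lra.
Qed.

Lemma null_point c : null (fun t => t = c).
Proof.
  intros e He. apply covers_weaken with (fun t => t = c) (c + e / 2 - (c - e / 2)); [easy|lra|].
  apply covers_interval; [lra|]. intros t ->. lra.
Qed.

Lemma covers_translate (A : R -> Prop) c r : covers_with A r -> covers_with (fun t => A (t + c)) r.
Proof.
  intros (a & b & H1 & H2 & H3). exists (fun n => a n - c), (fun n => b n - c).
  split; [|split].
  - intros n. specialize (H1 n). lra.
  - intros t Ht. destruct (H2 _ Ht) as [n Hn]. exists n. lra.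
  - intros n. rewrite (sum_eq _ (fun k => b k - a k)); [easy|]. intros; ring.
Qed.

Lemma ae_translate (P : R -> Prop) c : ae P -> ae (fun t => P (t + c)).
Proof.
  intros [A [HA HP]]. exists (fun t => A (t + c)). split.
  - intros e He. now apply covers_translate, HA.
  - intros t Ht. now apply HP.
Qed.

Lemma ae_and (P Q : R -> Prop) : ae P -> ae Q -> ae (fun t => P t /\ Q t).
Proof.
  intros [A [HA HP]] [B [HB HQ]]. exists (fun t => A t \/ B t).
  split; [now apply null_union2|]. intros t Ht. split; [apply HP|apply HQ]; tauto.
Qed.

Lemma ae_all (P : nat -> R -> Prop) : (forall n, ae (P n)) -> ae (fun t => forall n, P n t).
Proof.
  intros H. destruct (choice_fun _ H) as [A HA]. exists (fun t => exists n, A n t). split.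
  - apply null_union. apply HA.
  - intros t Ht n. apply HA. intros Hn. apply Ht. now exists n.
Qed.

Lemma ae_neq c : ae (fun t => t <> c).
Proof. exists (fun t => t = c). split; [apply null_point|easy]. Qed.

Lemma ae_impl (P Q : R -> Prop) : (forall t, P t -> Q t) -> ae P -> ae Q.
Proof. intros H [A [HA HP]]. exists A. split; auto. Qed.

(** The infimum of the bounds, taken as the negative of a supremum, is itself a bound because
    [outer_le] already tolerates an arbitrary excess. *)
Lemma outer_measure_exists (A : R -> Prop) r :
  outer_le A r -> exists mu, outer_le A mu /\ outer_ge A mu.
Proof.
  intros Hr. destruct (completeness (fun s => outer_le A (- s))) as [s [Hub Hlub]].
  - exists 0. intros s Hs. apply outer_le_nonneg in Hs. lra.
  - exists (- r). now rewrite Ropp_involutive.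
  - exists (- s). split.
    + intros e He.
      assert (Hex : exists q, outer_le A (- q) /\ s - e / 2 < q).
      { apply NNPP. intros Hn. assert (s <= s - e / 2); [|lra].
        apply Hlub. intros q Hq. destruct (Rle_dec q (s - e / 2)); [easy|].
        exfalso. apply Hn. exists q. split; [easy|lra]. }
      destruct Hex as [q [Hq Hlt]].
      apply covers_weaken with A (- q + e / 2); [easy|lra|apply Hq; lra].
    + intros r' Hr'. assert (- r' <= s); [|lra]. apply Hub. now rewrite Ropp_involutive.
Qed.

(** Caratheodory's criterion for half-lines: every interval of a cover is cut at [c], and the
    lengths of the two pieces add up to the original length. *)
Lemma outer_le_split c X r : outer_le X r -> exists r1 r2,
  outer_le (fun t => X t /\ t <= c) r1 /\ outer_le (fun t => X t /\ c <= t) r2 /\ r1 + r2 <= r.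
Proof.
  intros HX.
  (* Cutting an open interval at [c] loses the point [c], so the strict half-lines are measured and
     the null set [t = c] is added back. *)
  destruct (outer_measure_exists (fun t => X t /\ t < c) r) as [r1 [H1 G1]].
  { eapply outer_le_subset; [|exact HX]. tauto. }
  destruct (outer_measure_exists (fun t => X t /\ c < t) r) as [r2 [H2 G2]].
  { eapply outer_le_subset; [|exact HX]. tauto. }
  exists r1, r2. split; [|split].
  - replace r1 with (r1 + 0) by ring.
    eapply outer_le_subset; [|apply (outer_le_union _ _ _ _ H1 (null_point c))].
    intros t [Ht [Hlt| ->]]; [left; easy|now right].
  - replace r2 with (r2 + 0) by ring.
    eapply outer_le_subset; [|apply (outer_le_union _ _ _ _ H2 (null_point c))].
    intros t [Ht [Hlt| ->]]; [left; easy|now right].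
  - apply le_epsilon. intros e He. destruct (HX e He) as (a & b & Ha & Hb & Hs).
    set (L := fun k => Rmin (b k) c - Rmin (a k) c).
    set (M := fun k => Rmax (b k) c - Rmax (a k) c).
    assert (HL : forall k, 0 <= L k /\ 0 <= M k /\ L k + M k = b k - a k).
    { intros k. specialize (Ha k). unfold L, M, Rmin, Rmax.
      destruct (Rle_dec (b k) c), (Rle_dec (a k) c); lra. }
    assert (HLM : forall n m, sum_f_R0 L n + sum_f_R0 M m <= r + e).
    { intros n m. specialize (Hs (Nat.max n m)).
      rewrite (sum_eq _ (fun k => L k + M k)) in Hs by (intros; symmetry; apply HL).
      rewrite sum_plus in Hs.
      assert (sum_f_R0 L n <= sum_f_R0 L (Nat.max n m)) by (apply sum_le_mono; [apply HL|lia]).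
      assert (sum_f_R0 M m <= sum_f_R0 M (Nat.max n m)) by (apply sum_le_mono; [apply HL|lia]).
      lra. }
    (* [s] is the total length of the left pieces. Any left partial sum plus any right partial sum
       is at most [r + e], which leaves at most [r + e - s] for the right pieces. *)
    destruct (completeness (fun s => exists n, s = sum_f_R0 L n)) as [s [Hub Hlub]].
    { exists (r + e). intros s [n ->]. specialize (HLM n 0%nat).
      pose proof (cond_pos_sum M 0 (fun k => proj1 (proj2 (HL k)))). lra. }
    { now exists (sum_f_R0 L 0), 0%nat. }
    assert (r1 <= s).
    { apply G1, covers_outer_le. exists (fun k => Rmin (a k) c), (fun k => Rmin (b k) c).
      split; [|split].
      - intros k. destruct (HL k) as [? _]. unfold L in *. lra.
      - intros t [Ht Htc]. destruct (Hb t Ht) as [k Hk]. exists k.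
        unfold Rmin. destruct (Rle_dec (a k) c), (Rle_dec (b k) c); lra.
      - intros n. apply Hub. now exists n. }
    assert (r2 <= r + e - s).
    { apply G2, covers_outer_le. exists (fun k => Rmax (a k) c), (fun k => Rmax (b k) c).
      split; [|split].
      - intros k. destruct (HL k) as [_ [? _]]. unfold M in *. lra.
      - intros t [Ht Htc]. destruct (Hb t Ht) as [k Hk]. exists k.
        unfold Rmax. destruct (Rle_dec (a k) c), (Rle_dec (b k) c); lra.
      - intros n. fold M. assert (s <= r + e - sum_f_R0 M n); [|unfold M in *; lra].
        apply Hlub. intros q [k ->]. specialize (HLM k n). lra. }
    lra.
Qed.

Lemma leb_meas_le c : leb_meas (fun t => t <= c).
Proof.
  intros X r HX. destruct (outer_le_split c X r HX) as (r1 & r2 & H1 & H2 & H).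
  exists r1, r2. split; [easy|split; [|easy]].
  eapply outer_le_subset; [|exact H2]. intros t [Ht Hn]. split; [easy|lra].
Qed.

Lemma leb_meas_ge c : leb_meas (fun t => c <= t).
Proof.
  intros X r HX. destruct (outer_le_split c X r HX) as (r1 & r2 & H1 & H2 & H).
  exists r2, r1. split; [easy|split; [|lra]].
  eapply outer_le_subset; [|exact H1]. intros t [Ht Hn]. split; [easy|lra].
Qed.

Lemma leb_meas_not E : leb_meas E -> leb_meas (fun t => ~ E t).
Proof.
  intros HE X r HX. destruct (HE X r HX) as (r1 & r2 & H1 & H2 & H).
  exists r2, r1. split; [easy|split; [|lra]].
  eapply outer_le_subset; [|exact H1]. intros t [Ht Hn]. split; [easy|now apply NNPP].
Qed.

Lemma leb_meas_and E F : leb_meas E -> leb_meas F -> leb_meas (fun t => E t /\ F t).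
Proof.
  intros HE HF X r HX. destruct (HE X r HX) as (r1 & r2 & H1 & H2 & H).
  destruct (HF _ _ H1) as (r3 & r4 & H3 & H4 & H').
  exists r3, (r4 + r2). split; [|split; [|lra]].
  - eapply outer_le_subset; [|exact H3]. tauto.
  - eapply outer_le_subset; [|exact (outer_le_union _ _ _ _ H4 H2)].
    intros t [Ht Hn]. destruct (classic (E t)); tauto.
Qed.

(** * Absolute continuity from an integrable bound on the derivative *)

Lemma unit_level x : 0 < x -> exists j : nat, INR j < x <= INR j + 1.
Proof.
  intros Hx. destruct (INR_unbounded x) as [n Hn]. apply Rlt_le in Hn.
  induction n as [|n IH]; [simpl in Hn; lra|]. rewrite S_INR in Hn.
  destruct (Rle_dec x (INR n)); [auto|]. exists n. lra.
Qed.

Lemma bounded_sum_tail (F : nat -> R) B e :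
  0 < e -> (forall n, sum_f_R0 F n <= B) ->
  exists M, forall n, sum_f_R0 F n <= sum_f_R0 F M + e.
Proof.
  intros He HB.
  destruct (completeness (fun s => exists n, s = sum_f_R0 F n)) as [s [Hub Hlub]].
  - exists B. intros s [n ->]. apply HB.
  - now exists (sum_f_R0 F 0), 0%nat.
  - apply NNPP. intros Hn. assert (s <= s - e); [|lra].
    apply Hlub. intros q [M ->]. destruct (Rle_dec (sum_f_R0 F M) (s - e)) as [|Hlt]; [easy|].
    exfalso. apply Hn. exists M. intros n.
    assert (sum_f_R0 F n <= s) by (apply Hub; now exists n). lra.
Qed.

(** For [a <= b], [clamp a b t - a] is the length of the part of [[a, b]] to the left of [t], that
    is, a primitive of the indicator of [[a, b]]. *)
Definition clamp (a b t : R) : R := Rmin (Rmax t a) b.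

Lemma clamp_bounds a b t : a <= b -> a <= clamp a b t <= b.
Proof. intros. unfold clamp, Rmin, Rmax. repeat destruct (Rle_dec _ _); lra. Qed.

Lemma clamp_mono a b s t : s <= t -> clamp a b s <= clamp a b t.
Proof. intros. unfold clamp, Rmin, Rmax. repeat destruct (Rle_dec _ _); lra. Qed.

Lemma clamp_id a b t : a <= t <= b -> clamp a b t = t.
Proof. intros. unfold clamp, Rmin, Rmax. repeat destruct (Rle_dec _ _); lra. Qed.

(** The simple function with value [j] on the level [j < m <= j + 1] lies below [|m|], so
    [int_abs_finite] bounds the partial sums of [INR j * mu j], and their tail is small. *)
Lemma L1loc_level_tail m a b eps :
  L1loc m -> a <= b -> 0 < eps -> exists (M : nat) (mu : nat -> R),
    (forall j, outer_le (fun t => a <= t <= b /\ INR j < m t <= INR j + 1) (mu j)) /\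
    (forall n, sum_f_R0 (fun j => if le_dec j M then 0 else INR j * mu j) n <= eps).
Proof.
  intros [Hm HI] Hab He.
  (* The upper bound on [m t] is a negated strict inequality because [leb_meas_fun] speaks of the
     sets [c < m t]. *)
  set (E := fun j t => (a <= t /\ t <= b) /\ INR j < m t /\ ~ INR (S j) < m t).
  (* [mu j] has to be the exact outer measure: as a lower bound it is a weight in [int_abs_finite],
     as an upper bound it provides covers. *)
  assert (Hmu : forall j, exists mu, outer_le (E j) mu /\ outer_ge (E j) mu).
  { intros j. apply outer_measure_exists with (r := (b + 1) - (a - 1)).
    apply covers_outer_le, covers_interval; [lra|]. intros t [Ht _]. lra. }
  destruct (choice_fun _ Hmu) as [mu Hmu']. clear Hmu.
  assert (Hpos : forall j, 0 <= INR j * mu j).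
  { intros j. apply Rmult_le_pos; [apply pos_INR|]. eapply outer_le_nonneg, Hmu'. }
  destruct (HI a b Hab) as [B HB].
  destruct (bounded_sum_tail (fun j => INR j * mu j) B eps He) as [M HM].
  { intros n. apply HB with (E := E).
    - intros j _.
      repeat apply leb_meas_and; auto using leb_meas_ge, leb_meas_le, leb_meas_not.
    - intros i j t _ _ Hij [_ Hi] [_ Hj]. rewrite S_INR in *.
      destruct (Nat.lt_gt_cases i j) as [Hc _]. destruct (Hc Hij) as [Hlt|Hlt];
        apply le_INR in Hlt; rewrite S_INR in Hlt; lra.
    - intros j t _ [Ht Hj]. split; [easy|]. pose proof (RRle_abs (m t)). lra.
    - intros j _. split; [apply pos_INR|apply Hmu']. }
  exists M, mu. split.
  { intros j. eapply outer_le_subset; [|apply Hmu']. intros t Ht. unfold E. rewrite S_INR. lra. }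
  assert (Hs : forall n, sum_f_R0 (fun j => if le_dec j M then 0 else INR j * mu j) n =
     sum_f_R0 (fun j => INR j * mu j) n - sum_f_R0 (fun j => INR j * mu j) (Nat.min n M)).
  { induction n as [|n IH].
    - simpl. destruct (le_dec 0 M); [|lia]. lra.
    - rewrite !tech5, IH. destruct (le_dec (S n) M).
      + rewrite !Nat.min_l by lia. rewrite tech5. lra.
      + rewrite !Nat.min_r by lia. lra. }
  intros n. rewrite Hs. destruct (Nat.le_gt_cases n M).
  - rewrite Nat.min_l by lia. lra.
  - rewrite Nat.min_r by lia. specialize (HM n). lra.
Qed.

(* [C s + H n s] is a primitive of a majorant of [m + 1]: above level [C] the majorant is the
   sum of the levels [j + 2] times the indicators of open covers of the sets [j < m <= j + 1].
   The truncation at [n] replaces a limit, since a finite partition meets finitely many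
   intervals of these covers. *)
Lemma L1loc_primitive_majorant m a b eps :
  L1loc m -> a <= b -> 0 < eps -> exists (C : R) (H : nat -> R -> R),
    0 <= C /\
    (forall n s t, s <= t -> H n s <= H n t) /\
    (forall n s t, H n t - H n s <= eps) /\
    (forall t, a <= t <= b -> exists d n0, 0 < d /\ forall n u w, (n0 <= n)%nat ->
       t - d < u -> u <= t -> t <= w -> w < t + d ->
       (m t + 1) * (w - u) <= C * (w - u) + (H n w - H n u)).
Proof.
  intros Hm Hab He.
  (* For [j > M] one has [j + 2 <= 3 j], so the measures contribute at most three times [eps / 6].
     The excesses [(INR j + 2) * eta j = (/ 2) ^ j * (eps / 4)] contribute at most the other half of
     [eps]. *)
  destruct (L1loc_level_tail m a b (eps / 6) Hm Hab) as (M & mu & Hmu & HM); [lra|].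
  set (eta := fun j : nat => (/ 2) ^ j * (eps / 4) / (INR j + 2)).
  assert (Heta : forall j, 0 < eta j).
  { intros j. pose proof (pos_INR j). unfold eta. apply Rdiv_lt_0_compat; [|lra].
    apply Rmult_lt_0_compat; [apply pow_lt; lra|lra]. }
  assert (Hcov := fun j => Hmu j (eta j) (Heta j)).
  destruct (choice_fun _ Hcov) as [p Hp]. destruct (choice_fun _ Hp) as [q Hq].
  clear Hcov Hp.
  assert (Hpq : forall j k, p j k <= q j k) by (intros j; apply Hq).
  (* [W n j] is a primitive of the sum of the indicators of the first [n + 1] intervals covering
     level [j]; the factor [INR j + 2] in [H] bounds [m + 1] on that level. *)
  set (W := fun n j t => sum_f_R0 (fun k => clamp (p j k) (q j k) t - p j k) n).
  set (H := fun n t => sum_f_R0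
              (fun j => if le_dec j M then 0 else (INR j + 2) * W n j t) n).
  assert (HW0 : forall n j t, 0 <= W n j t <= mu j + eta j).
  { intros n j t. split.
    - apply cond_pos_sum. intros k. pose proof (clamp_bounds _ _ t (Hpq j k)). lra.
    - destruct (Hq j) as (_ & _ & H3). eapply Rle_trans; [|apply (H3 n)].
      apply sum_Rle. intros k _. pose proof (clamp_bounds _ _ t (Hpq j k)). lra. }
  assert (HWm : forall n j s t, s <= t -> W n j s <= W n j t).
  { intros n j s t Hst. apply sum_Rle. intros k _.
    pose proof (clamp_mono (p j k) (q j k) _ _ Hst). lra. }
  assert (Hmono : forall n s t, s <= t -> H n s <= H n t).
  { intros n s t Hst. apply sum_Rle. intros j _. destruct (le_dec j M); [lra|].
    apply Rmult_le_compat_l; [pose proof (pos_INR j); lra|auto]. }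
  assert (H0 : forall n t, 0 <= H n t).
  { intros n t. apply cond_pos_sum. intros j. destruct (le_dec j M); [lra|].
    pose proof (pos_INR j). specialize (HW0 n j t). nra. }
  assert (H1 : forall n t, H n t <= eps).
  { intros n t. apply Rle_trans with
      (sum_f_R0 (fun j => (if le_dec j M then 0 else INR j * mu j) * 3 +
                          (/ 2) ^ j * (eps / 4)) n).
    - apply sum_Rle. intros j _.
      assert (0 < (/ 2) ^ j * (eps / 4)) by (apply Rmult_lt_0_compat; [apply pow_lt; lra|lra]).
      destruct (le_dec j M) as [|Hj]; [lra|].
      assert (1 <= INR j) by (change 1 with (INR 1); apply le_INR; lia).
      pose proof (outer_le_nonneg _ _ (Hmu j)). specialize (HW0 n j t).
      apply Rle_trans with ((INR j + 2) * (mu j + eta j)).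
      + apply Rmult_le_compat_l; lra.
      + assert ((INR j + 2) * eta j = (/ 2) ^ j * (eps / 4)) by (unfold eta; field; lra).
        nra.
    - rewrite sum_plus, <- (scal_sum _ n 3), <- (scal_sum (fun n => (/ 2) ^ n)).
      specialize (HM n). pose proof (sum_half n) as Hn.
      apply Rmult_le_compat_l with (r := eps / 4) in Hn; lra. }
  (* Where [m] is at most [M + 1], the constant alone dominates [m + 1]. *)
  exists (INR M + 2), H. split; [pose proof (pos_INR M); lra|]. split; [easy|].
  split; [intros n s t; specialize (H0 n s); specialize (H1 n t); lra|].
  intros t Ht. destruct (Rle_dec (m t) (INR M + 1)) as [Hle|Hgt].
  - exists 1, 0%nat. split; [lra|]. intros n u w _ _ Hu Hw _.
    assert (Huw : u <= w) by lra. pose proof (Hmono n u w Huw). nra.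
  - destruct (unit_level (m t)) as [j Hj]; [pose proof (pos_INR M); lra|].
    assert (HjM : (M < j)%nat).
    { apply INR_lt. lra. }
    destruct (Hq j) as (_ & H2 & _). destruct (H2 t) as [k Hk]; [easy|].
    (* The neighbourhood of [t] lies inside interval [k] of the cover of level [j], and [H n] counts
       this interval once [n] reaches both [j] and [k]. *)
    exists (Rmin (t - p j k) (q j k - t)), (Nat.max j k).
    split; [apply Rmin_glb_lt; lra|]. intros n u w Hn Hu Hu' Hw Hw'.
    pose proof (Rmin_l (t - p j k) (q j k - t)). pose proof (Rmin_r (t - p j k) (q j k - t)).
    assert (Huw : u <= w) by lra.
    assert (HWuw : w - u <= W n j w - W n j u).
    { unfold W. rewrite <- minus_sum.
      eapply Rle_trans; [|apply sum_term_le with (j := k); [|lia]].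
      - cbv beta. rewrite !clamp_id by lra. lra.
      - intros i. pose proof (clamp_mono (p j i) (q j i) _ _ Huw). lra. }
    assert (HHuw : (INR j + 2) * (W n j w - W n j u) <= H n w - H n u).
    { unfold H. rewrite <- minus_sum.
      eapply Rle_trans; [|apply sum_term_le with (j := j); [|lia]].
      - cbv beta. destruct (le_dec j M); [lia|]. lra.
      - intros i. destruct (le_dec i M); [lra|]. pose proof (HWm n i _ _ Huw).
        pose proof (pos_INR i). nra. }
    pose proof (pos_INR j). pose proof (pos_INR M).
    assert ((m t + 1) * (w - u) <= (INR j + 2) * (w - u)) by (apply Rmult_le_compat_r; lra).
    assert ((INR j + 2) * (w - u) <= (INR j + 2) * (W n j w - W n j u))
      by (apply Rmult_le_compat_l; lra).
    assert (0 <= (INR M + 2) * (w - u)) by (apply Rmult_le_pos; lra).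
    lra.
Qed.

(** * Chains of intervals and the bound on increments *)

Fixpoint chain (a b : R) (l : list (R * R)) : Prop :=
  match l with
  | nil => a <= b
  | q :: l' => a <= fst q /\ fst q <= snd q /\ chain (snd q) b l'
  end.

Lemma chain_app a b c l l' : chain a b l -> chain b c l' -> chain a c (l ++ l').
Proof.
  revert a. induction l as [|q l IH]; simpl; intros a H H'.
  - destruct l' as [|q l']; simpl in *; [lra|]. intuition lra.
  - intuition.
Qed.

Lemma chain_widen a a' b l : a' <= a -> chain a b l -> chain a' b l.
Proof. destruct l as [|q l]; simpl; [lra|intuition lra]. Qed.

Lemma chain_nth a b l k : chain a b l -> (k < length l)%nat ->
  a <= fst (nth k l (0, 0)) /\ fst (nth k l (0, 0)) <= snd (nth k l (0, 0)) /\
  snd (nth k l (0, 0)) <= b /\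
  ((S k < length l)%nat -> snd (nth k l (0, 0)) <= fst (nth (S k) l (0, 0))).
Proof.
  assert (Hle : forall l a, chain a b l -> a <= b).
  { clear. induction l as [|q l IH]; simpl; intros a; [easy|].
    intros (H1 & H2 & H3). specialize (IH _ H3). lra. }
  revert a k. induction l as [|q l IH]; intros a k H Hk; [simpl in Hk; lia|].
  destruct H as (H1 & H2 & H3). destruct k as [|k].
  - simpl. pose proof (Hle _ _ H3). repeat split; try lra.
    intros Hl. destruct l as [|q' l]; [simpl in Hl; lia|]. simpl in *. lra.
  - simpl in Hk. destruct (IH _ k H3) as (I1 & I2 & I3 & I4); [lia|].
    simpl. repeat split; try lra. intros Hl. apply I4. lia.
Qed.

Lemma sum_nth_lsum (F : R * R -> R) q l :
  sum_f_R0 (fun k => F (nth k (q :: l) (0, 0))) (length l) = lsum F (q :: l).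
Proof.
  revert q. induction l as [|q' l IH]; intros q; [simpl; ring|].
  simpl length. rewrite decomp_sum by lia. simpl pred.
  change (lsum F (q :: q' :: l)) with (F q + lsum F (q' :: l)). rewrite <- IH. reflexivity.
Qed.

(** Chains turn the families of [AC] into lists, which can be concatenated during interval induction
    and may be empty, whereas a family in [AC] has at least one interval. *)
Lemma AC_chain {N} (x : R -> vec N) a b : AC x a b ->
  forall eps, 0 < eps -> exists del, 0 < del /\ forall l, chain a b l ->
    lsum (fun q => snd q - fst q) l < del ->
    lsum (fun q => vnorm (vsub (x (snd q)) (x (fst q)))) l < eps.
Proof.
  intros H eps He. destruct (H eps He) as [del [Hd H']]. exists del. split; [easy|].
  intros [|q l] Hc Hs; [simpl; lra|].
  rewrite <- sum_nth_lsum in *.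
  apply H' with (u := fun k => fst (nth k (q :: l) (0, 0)))
                (w := fun k => snd (nth k (q :: l) (0, 0))).
  - intros k Hk. destruct (chain_nth _ _ _ k Hc) as (H1 & H2 & H3 & _); [simpl; lia|]. easy.
  - intros k Hk. apply (chain_nth _ _ _ k Hc); simpl; lia.
  - exact Hs.
Qed.

(** The straddle lemma: the two sides of [t] are estimated separately, and since [u <= t <= w] the
    errors [(w - t) * e] and [(t - u) * e] add up to [(w - u) * e]. *)
Lemma derivable_pt_lim_straddle F t l e : 0 < e -> derivable_pt_lim F t l ->
  exists d, 0 < d /\ forall u w, t - d < u -> u <= t -> t <= w -> w < t + d ->
    Rabs (F w - F u - (w - u) * l) <= (w - u) * e.
Proof.
  intros He HF. destruct (HF e He) as [d Hd]. exists d. split; [apply cond_pos|].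
  assert (H : forall h, Rabs h < d -> Rabs (F (t + h) - F t - h * l) <= Rabs h * e).
  { intros h Hh. destruct (Req_dec h 0) as [->|Hn].
    - rewrite Rplus_0_r, Rmult_0_l, Rabs_R0. rewrite Rminus_diag, Rminus_0_r, Rabs_R0. lra.
    - specialize (Hd h Hn Hh).
      replace (F (t + h) - F t - h * l) with (h * ((F (t + h) - F t) / h - l)) by (field; easy).
      rewrite Rabs_mult. apply Rmult_le_compat_l; [apply Rabs_pos|lra]. }
  intros u w Hu Hu' Hw Hw'.
  assert (H1 := H (w - t)). assert (H2 := H (u - t)).
  replace (t + (w - t)) with w in H1 by ring. replace (t + (u - t)) with u in H2 by ring.
  rewrite (Rabs_right (w - t)) in H1 by lra. rewrite (Rabs_left1 (u - t)) in H2 by lra.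
  specialize (H1 ltac:(lra)). specialize (H2 ltac:(lra)).
  replace (F w - F u - (w - u) * l) with
    ((F w - F t - (w - t) * l) - (F u - F t - (u - t) * l)) by ring.
  pose proof (Rabs_triang (F w - F t - (w - t) * l) (- (F u - F t - (u - t) * l))) as H3.
  rewrite Rabs_Ropp in H3. unfold Rminus in *. lra.
Qed.

Lemma vderiv_straddle {N} (x : R -> vec N) t (D : vec N) :
  (forall i, derivable_pt_lim (fun u => x u i) t (D i)) ->
  exists d, 0 < d /\ forall u w, t - d < u -> u <= t -> t <= w -> w < t + d ->
    vnorm (vsub (x w) (x u)) <= (vnorm D + 1) * (w - u).
Proof.
  intros H. pose proof (pos_INR N).
  (* With this error in each of the [N] coordinates the total error is at most [w - u], the source
     of the summand 1 in [m + 1]. *)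
  assert (He : 0 < / (INR N + 1)) by (apply Rinv_0_lt_compat; lra).
  destruct (fin_uniform_radius N (fun i d => forall u w, t - d < u -> u <= t -> t <= w -> w < t + d ->
      Rabs (x w i - x u i - (w - u) * D i) <= (w - u) * / (INR N + 1))) as [d [Hd H']].
  - intros i r r' Hr Hi u w H1 H2 H3 H4. apply Hi; lra.
  - intros i. exact (derivable_pt_lim_straddle _ _ _ _ He (H i)).
  - exists d. split; [easy|]. intros u w H1 H2 H3 H4.
    eapply Rle_trans; [apply (vnorm_le_sub _ (fun i => (w - u) * D i))|].
    rewrite vnorm_scal, Rabs_right by lra.
    assert (vnorm (vsub (vsub (x w) (x u)) (fun i => (w - u) * D i)) <= w - u); [|lra].
    eapply Rle_trans; [apply vnorm_le_coords with (e := (w - u) * / (INR N + 1))|].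
    + apply Rmult_le_pos; lra.
    + intros i. unfold vsub. now apply H'.
    + assert (INR N * / (INR N + 1) <= 1).
      { apply Rmult_le_reg_r with (INR N + 1); [lra|]. rewrite Rmult_assoc, Rinv_l; lra. }
      nra.
Qed.

(** Around a point with controlled derivative the straddle estimate yields the majorant. Around a
    point of the null set [Z] the interval is set aside in a chain; the chain has small total length
    thanks to a cover of [Z], so absolute continuity keeps its increments below [eta]. *)
Lemma increment_le_majorant {N} (x D : R -> vec N) m C H a b :
  (forall n s t, s <= t -> (H : nat -> R -> R) n s <= H n t) -> 0 <= C ->
  (forall t, a <= t <= b -> exists d n0, 0 < d /\ forall n u w, (n0 <= n)%nat ->
     t - d < u -> u <= t -> t <= w -> w < t + d ->
     (m t + 1) * (w - u) <= C * (w - u) + (H n w - H n u)) ->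
  AC x a b ->
  ae (fun t => a <= t <= b ->
        (forall i, derivable_pt_lim (fun u => x u i) t (D t i)) /\ vnorm (D t) <= m t) ->
  forall u w eta, a <= u -> u <= w -> w <= b -> 0 < eta ->
  exists n0, forall n, (n0 <= n)%nat ->
    vnorm (vsub (x w) (x u)) <= C * (w - u) + (H n w - H n u) + eta.
Proof.
  intros Hmono HC Hloc HAC [Z [HZ HD]] u w eta Hu Huw Hw Heta.
  destruct (AC_chain x a b HAC eta Heta) as [del [Hdel Hch]].
  destruct (HZ (del / 2)) as (p & q & Hpq & Hcov & Hsum); [lra|].
  (* As a primitive of the cover of [Z], [Q] has additive increments, at least the length of each
     interval set aside; this controls the length of the chain. *)
  set (Q := fun n t => sum_f_R0 (fun k => clamp (p k) (q k) t - p k) n).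
  assert (HQ : forall n s t, s <= t -> Q n s <= Q n t).
  { intros n s t Hst. apply sum_Rle. intros k _. pose proof (clamp_mono (p k) (q k) _ _ Hst). lra. }
  set (P := fun c e => exists l n0, chain c e l /\ forall n, (n0 <= n)%nat ->
     vnorm (vsub (x e) (x c)) <= C * (e - c) + (H n e - H n c) +
        lsum (fun q => vnorm (vsub (x (snd q)) (x (fst q)))) l /\
     lsum (fun q => snd q - fst q) l <= Q n e - Q n c).
  assert (HP : P u w).
  { apply interval_induction; [easy| |].
    - intros c e g _ _ _ _ (l1 & n1 & Hc1 & H1) (l2 & n2 & Hc2 & H2).
      exists (l1 ++ l2), (Nat.max n1 n2). split; [eapply chain_app; eauto|].
      intros n Hn. destruct (H1 n) as [I1 J1]; [lia|]. destruct (H2 n) as [I2 J2]; [lia|].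
      rewrite !lsum_app. split; [|lra].
      pose proof (vnorm_sub_triangle (x e) (x g) (x c)). lra.
    - intros t Ht. destruct (classic (Z t)) as [Zt|Zt].
      + destruct (Hcov t Zt) as [k Hk].
        exists (Rmin (t - p k) (q k - t)). split; [apply Rmin_glb_lt; lra|].
        intros c e H1 H2 H3 H4 H5 H6.
        pose proof (Rmin_l (t - p k) (q k - t)). pose proof (Rmin_r (t - p k) (q k - t)).
        exists ((c, e) :: nil), k. split; [simpl; lra|]. intros n Hn. simpl.
        assert (Hce : c <= e) by lra. split.
        * pose proof (Hmono n c e Hce). assert (0 <= C * (e - c)) by (apply Rmult_le_pos; lra). lra.
        * unfold Q. rewrite <- minus_sum.
          eapply Rle_trans; [|apply sum_term_le with (j := k); [|lia]].
          -- cbv beta. rewrite !clamp_id by lra. lra.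
          -- intros i. pose proof (clamp_mono (p i) (q i) _ _ Hce). lra.
      + destruct (HD t Zt) as [Hder HDm]; [lra|].
        destruct (vderiv_straddle x t (D t) Hder) as [d1 [Hd1 K1]].
        destruct (Hloc t) as (d2 & n0 & Hd2 & K2); [lra|].
        exists (Rmin d1 d2). split; [apply Rmin_glb_lt; lra|].
        intros c e H1 H2 H3 H4 H5 H6. pose proof (Rmin_l d1 d2). pose proof (Rmin_r d1 d2).
        exists nil, n0. split; [simpl; lra|]. intros n Hn. simpl.
        assert (Hce : c <= e) by lra. pose proof (HQ n c e Hce). split; [|lra].
        specialize (K1 c e). specialize (K2 n c e Hn).
        specialize (K1 ltac:(lra) ltac:(lra) ltac:(lra) ltac:(lra)).
        specialize (K2 ltac:(lra) ltac:(lra) ltac:(lra) ltac:(lra)).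
        assert ((vnorm (D t) + 1) * (e - c) <= (m t + 1) * (e - c))
          by (apply Rmult_le_compat_r; lra).
        lra. }
  destruct HP as (l & n0 & Hl & HP). exists n0. intros n Hn. destruct (HP n Hn) as [H1 H2].
  assert (lsum (fun q => vnorm (vsub (x (snd q)) (x (fst q)))) l < eta); [|lra].
  apply Hch.
  - assert (Hright : forall l c, chain c w l -> chain c b l).
    { clear - Hw. induction l as [|q l IH]; simpl; intros c; [lra|intuition]. }
    apply Hright. eapply chain_widen; eauto.
  - assert (Q n w - Q n u <= del / 2); [|lra].
    unfold Q. rewrite <- minus_sum. eapply Rle_trans; [|rewrite Rplus_0_l in Hsum; apply (Hsum n)].
    apply sum_Rle. intros k _.
    pose proof (clamp_bounds _ _ u (Hpq k)). pose proof (clamp_bounds _ _ w (Hpq k)). lra.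
Qed.

Lemma ordered_increments_le (F : R -> R) (u w : nat -> R) n :
  (forall s t, s <= t -> F s <= F t) ->
  (forall k, (k < n)%nat -> w k <= u (S k)) ->
  sum_f_R0 (fun k => F (w k) - F (u k)) n <= F (w n) - F (u 0%nat).
Proof.
  intros HF H. induction n as [|n IH]; simpl; [lra|].
  assert (F (w n) <= F (u (S n))) by (apply HF, H; lia).
  assert (sum_f_R0 (fun k => F (w k) - F (u k)) n <= F (w n) - F (u 0%nat)) by (apply IH; intros; apply H; lia).
  lra.
Qed.

(** The point is that [del] depends on [m], [a], [b] and [eps] alone: one modulus serves a solution
    on all intervals approaching an endpoint not yet known to be reached. *)
Lemma uniform_AC_of_derivative_bound m a b eps :
  L1loc m -> a <= b -> 0 < eps -> exists del, 0 < del /\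
  forall N (x D : R -> vec N) a' b', a <= a' -> b' <= b -> AC x a' b' ->
    ae (fun t => a' <= t <= b' ->
          (forall i, derivable_pt_lim (fun u => x u i) t (D t i)) /\ vnorm (D t) <= m t) ->
    forall (n : nat) (u w : nat -> R),
      (forall k, (k <= n)%nat -> a' <= u k /\ u k <= w k /\ w k <= b') ->
      (forall k, (k < n)%nat -> w k <= u (S k)) ->
      sum_f_R0 (fun k => w k - u k) n < del ->
      sum_f_R0 (fun k => vnorm (vsub (x (w k)) (x (u k)))) n < eps.
Proof.
  intros Hm Hab He.
  destruct (L1loc_primitive_majorant m a b (eps / 4) Hm Hab) as (C & H & HC & Hmono & Hvar & Hloc);
    [lra|].
  (* At most [eps / 4] comes from each of three sources: [C] times the total length, the variation
     of [H], and the [n + 1] slacks [eta]. *)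
  exists (eps / 4 / (C + 1)). split; [apply Rdiv_lt_0_compat; lra|].
  intros N x D a' b' Ha Hb HAC HD n u w Huw Hord Hsum.
  set (eta := eps / 4 / (INR n + 1)). pose proof (pos_INR n).
  assert (Heta : 0 < eta) by (apply Rdiv_lt_0_compat; lra).
  assert (Hk : forall k, exists n0, (k <= n)%nat -> forall i, (n0 <= i)%nat ->
    vnorm (vsub (x (w k)) (x (u k))) <= C * (w k - u k) + (H i (w k) - H i (u k)) + eta).
  { intros k. destruct (le_dec k n) as [Hk|Hk]; [|exists 0%nat; lia].
    destruct (Huw k Hk) as (H1 & H2 & H3).
    destruct (increment_le_majorant x D m C H a' b') with (u := u k) (w := w k) (eta := eta)
      as [n0 Hn0]; auto.
    - intros t Ht. apply Hloc. lra.
    - now exists n0. }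
  destruct (choice_fun _ Hk) as [nk Hnk].
  (* One truncation index must serve all intervals, so that increments of a single monotone function
     are added. *)
  assert (Hi : exists i, forall k, (k <= n)%nat -> (nk k <= i)%nat).
  { clear. induction n as [|n [i Hi]].
    - exists (nk 0%nat). intros k Hk. replace k with 0%nat by lia. lia.
    - exists (Nat.max i (nk (S n))). intros k Hk.
      destruct (Nat.eq_dec k (S n)) as [->|]; [lia|]. specialize (Hi k ltac:(lia)). lia. }
  destruct Hi as [i Hi].
  apply Rle_lt_trans with (sum_f_R0 (fun k => (w k - u k) * C + (H i (w k) - H i (u k)) + eta) n).
  - apply sum_Rle. intros k Hkn. specialize (Hnk k Hkn i (Hi k Hkn)). lra.
  - rewrite !sum_plus, <- scal_sum, sum_cte, S_INR.
    pose proof (ordered_increments_le (H i) u w n (Hmono i) Hord).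
    pose proof (Hvar i (u 0%nat) (w n)).
    assert (eta * (INR n + 1) = eps / 4) by (unfold eta; field; lra).
    assert (C * sum_f_R0 (fun k => w k - u k) n <= C * (eps / 4 / (C + 1)))
      by (apply Rmult_le_compat_l; lra).
    assert (C * (eps / 4 / (C + 1)) <= eps / 4).
    { replace (C * (eps / 4 / (C + 1))) with (eps / 4 * (C / (C + 1))) by (field; lra).
      assert (C / (C + 1) <= 1).
      { apply Rmult_le_reg_r with (C + 1); [lra|]. unfold Rdiv. rewrite Rmult_assoc, Rinv_l; lra. }
      nra. }
    lra.
Qed.

(** * Caratheodory solutions *)

Lemma shift_shift {N} (h : LCF N) a b : shift (shift h a) b = shift h (a + b).
Proof.
  apply functional_extensionality; intros s. unfold shift. now replace (s + b + a) with (s + (a + b)) by ring.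
Qed.

Lemma shift_0 {N} (h : LCF N) : shift h 0 = h.
Proof. apply functional_extensionality; intros s. unfold shift. now rewrite Rplus_0_r. Qed.

Lemma derivable_pt_lim_translate F t c l :
  derivable_pt_lim F (t + c) l -> derivable_pt_lim (fun u => F (u + c)) t l.
Proof.
  intros H e He. destruct (H e He) as [d Hd]. exists d. intros h H1 H2.
  replace (t + h + c) with (t + c + h) by ring. auto.
Qed.

Lemma derivable_pt_lim_ext_loc F G a b t l :
  (forall s, a < s < b -> F s = G s) -> a < t < b ->
  derivable_pt_lim F t l -> derivable_pt_lim G t l.
Proof.
  intros HFG Ht H e He. destruct (H e He) as [d Hd].
  assert (Hp : 0 < Rmin d (Rmin (t - a) (b - t))).
  { repeat apply Rmin_glb_lt; try lra. apply cond_pos. }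
  exists (mkposreal _ Hp). simpl. intros h Hh Hlt.
  pose proof (Rmin_l d (Rmin (t - a) (b - t))). pose proof (Rmin_r d (Rmin (t - a) (b - t))).
  pose proof (Rmin_l (t - a) (b - t)). pose proof (Rmin_r (t - a) (b - t)).
  assert (Hb : - (Rmin d (Rmin (t - a) (b - t))) < h < Rmin d (Rmin (t - a) (b - t)))
    by (apply Rabs_def2 in Hlt; lra).
  rewrite <- !HFG by lra. apply Hd; [easy|lra].
Qed.

Lemma AC_ext {N} (x z : R -> vec N) a b :
  (forall s, a <= s <= b -> z s = x s) -> AC z a b -> AC x a b.
Proof.
  intros Hzx H e He. destruct (H e He) as [d [Hd Hd']]. exists d. split; [easy|].
  intros n u w Huw Ho Hs. rewrite (sum_eq _ (fun k => vnorm (vsub (z (w k)) (z (u k))))).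
  - now apply Hd'.
  - intros k Hk. specialize (Huw k Hk). rewrite !Hzx by lra. easy.
Qed.

Lemma AC_sub {N} (x : R -> vec N) a b a' b' : a <= a' -> b' <= b -> AC x a b -> AC x a' b'.
Proof.
  intros Ha Hb H e He. destruct (H e He) as [d [Hd Hd']]. exists d. split; [easy|].
  intros n u w Huw Ho Hs. apply Hd'; auto. intros k Hk. specialize (Huw k Hk). lra.
Qed.

Lemma AC_translate {N} (x : R -> vec N) a b c :
  AC x (a + c) (b + c) -> AC (fun t => x (t + c)) a b.
Proof.
  intros H e He. destruct (H e He) as [d [Hd Hd']]. exists d. split; [easy|].
  intros n u w Huw Ho Hs. apply (Hd' n (fun k => u k + c) (fun k => w k + c)).
  - intros k Hk. specialize (Huw k Hk). lra.
  - intros k Hk. specialize (Ho k Hk). lra.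
  - rewrite (sum_eq _ (fun k => w k - u k)); [easy|]. intros; ring.
Qed.

Lemma AC_const {N} (v : vec N) a b : AC (fun _ => v) a b.
Proof.
  intros e He. exists 1. split; [lra|]. intros n u w _ _ _.
  rewrite (sum_eq _ (fun _ => 0)) by (intros; apply vnorm_sub_self).
  now rewrite sum_eq_R0.
Qed.

Lemma sol_shift {N} (h : LCF N) s x0 J x r : sol h s x0 J x ->
  sol (shift h r) (s - r) x0 (fun t => J (t + r)) (fun t => x (t + r)).
Proof.
  intros (H1 & H2 & H3 & H4 & H5). split; [|split; [|split; [|split]]].
  - intros a b c Ha Hc Hb. apply (H1 (a + r) (b + r) (c + r)); auto. lra.
  - now replace (s - r + r) with s by ring.
  - now replace (s - r + r) with s by ring.
  - intros a b Ha Hb Hab. apply AC_translate, H4; auto. lra.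
  - eapply ae_impl; [|apply (ae_translate _ r H5)]. cbv beta. intros t Ht Jt i.
    apply (derivable_pt_lim_translate (fun u => x u i)). now apply Ht.
Qed.

Lemma sol_val_shift {N} (h : LCF N) s x0 t v r :
  sol_val h s x0 t v -> sol_val (shift h r) (s - r) x0 (t - r) v.
Proof.
  intros (J & x & H1 & H2 & H3). do 2 eexists. split; [apply (sol_shift _ _ _ _ _ r H1)|].
  cbv beta. now replace (t - r + r) with t by ring.
Qed.

Lemma sol_val_unshift {N} (h : LCF N) s x0 t v r :
  sol_val (shift h r) s x0 t v -> sol_val h (s + r) x0 (t + r) v.
Proof.
  intros H. apply (sol_val_shift _ _ _ _ _ (- r)) in H.
  rewrite shift_shift, Rplus_opp_r, shift_0 in H. unfold Rminus in H.
  now rewrite !Ropp_involutive in H.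
Qed.

(** [sol] admits the interval reduced to [s]: the equation is required almost everywhere and a point
    is null. *)
Lemma sol_val_refl {N} (h : LCF N) s x0 : sol_val h s x0 s x0.
Proof.
  exists (fun t => t = s), (fun _ => x0). split; [|easy].
  split; [|split; [|split; [|split]]]; try easy.
  - intros a b c Ha Hc Hb. lra.
  - intros a b _ _ _. apply AC_const.
  - eapply ae_impl; [|apply (ae_neq s)]. intros t Ht Hts. now destruct Ht.
Qed.

(** One pair [J], [x] witnesses both pieces. Minimum and maximum include solutions followed
    backwards in time. *)
Lemma sol_val_mid {N} (h : LCF N) s x0 t v r :
  Rmin s t <= r <= Rmax s t -> sol_val h s x0 t v ->
  exists z, sol_val h s x0 r z /\ sol_val h r z t v.
Proof.
  intros Hr (J & x & H1 & H2 & H3). destruct H1 as (I1 & I2 & I3 & I4 & I5).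
  assert (Jr : J r).
  { unfold Rmin, Rmax in Hr. destruct (Rle_dec s t).
    - apply (I1 s r t); auto.
    - apply (I1 t r s); auto. }
  exists (x r). split; exists J, x; repeat split; auto.
Qed.

(* A solution that stays in a compact set [K] moves at speed at most [m^K], hence it is
   uniformly continuous up to an endpoint of its interval of existence. *)
Lemma bounded_solution_reaches_endpoint {N} (g : LCF N) y c sigma :
  LC g -> 0 < sigma ->
  (forall t v v', sol_val g 0 y t v -> sol_val g 0 y t v' -> v = v') ->
  (forall t, - sigma < t <= 0 -> exists v, sol_val g 0 y t v /\ vnorm v <= c) ->
  exists v, sol_val g 0 y (- sigma) v.
Proof.
  intros [_ HLC] Hsig Huniq Hex.
  (* [x] collects one value for each time; uniqueness identifies it with any solution as far back as
     that solution goes. *)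
  destruct (choice_fun (fun t v => - sigma < t <= 0 -> sol_val g 0 y t v /\ vnorm v <= c)) as [x Hx].
  { intros t. destruct (classic (- sigma < t <= 0)) as [H|H].
    - destruct (Hex t H) as [v Hv]. now exists v.
    - exists y. easy. }
  assert (P1 : forall a, - sigma < a <= 0 -> exists J z, sol g 0 y J z /\ J a /\
             forall s, a <= s <= 0 -> z s = x s).
  { intros a Ha. destruct (Hx a Ha) as [(J & z & H1 & H2 & H3) _].
    exists J, z. split; [easy|split; [easy|]]. intros s Hs.
    apply (Huniq s); [|apply Hx; lra]. exists J, z. split; [easy|]. split; [|easy].
    destruct H1 as (I1 & I2 & _). apply (I1 a s 0); auto. }
  assert (P2 : forall a b, - sigma < a -> b <= 0 -> AC x a b).
  { intros a b Ha Hb. destruct (Rle_dec a b) as [Hab|Hab].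
    - destruct (P1 a) as (J & z & H1 & H2 & H3); [lra|].
      apply AC_ext with z; [intros s Hs; apply H3; lra|].
      apply AC_sub with a 0; [lra|lra|]. destruct H1 as (_ & I2 & _ & I4 & _).
      apply I4; auto. lra.
    - intros e He. exists 1. split; [lra|]. intros n u w Huw _ _.
      specialize (Huw 0%nat ltac:(lia)). lra. }
  set (s := fun n : nat => - sigma + sigma / (INR n + 2)).
  assert (Hs : forall n, - sigma < s n <= 0).
  { intros n. unfold s. pose proof (pos_INR n).
    assert (0 < sigma / (INR n + 2)) by (apply Rdiv_lt_0_compat; lra).
    assert (sigma / (INR n + 2) <= sigma); [|lra].
    apply Rmult_le_reg_r with (INR n + 2); [lra|]. unfold Rdiv. rewrite Rmult_assoc, Rinv_l by lra. nra. }
  assert (Hsn : forall rho, 0 < rho -> exists n0, forall n, (n0 <= n)%nat -> s n < - sigma + rho).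
  { intros rho Hrho. destruct (INR_unbounded (sigma / rho)) as [n0 Hn0]. exists n0.
    intros n Hn. apply le_INR in Hn. pose proof (pos_INR n). unfold s.
    assert (sigma / (INR n + 2) < rho); [|lra].
    apply Rmult_lt_reg_r with (INR n + 2); [lra|]. unfold Rdiv at 1. rewrite Rmult_assoc, Rinv_l by lra.
    assert (sigma / rho * rho = sigma) by (field; lra). nra. }
  (* Each solution brings its own exceptional null set, so the equation is first obtained on the
     countably many intervals [(s n, 0)], which exhaust [(- sigma, 0)]. *)
  assert (P3 : ae (fun t => - sigma < t < 0 ->
                 forall i, derivable_pt_lim (fun u => x u i) t (g t (x t) i))).
  { eapply ae_impl; [|apply ae_all with (P := fun n t => s n < t < 0 ->
                 forall i, derivable_pt_lim (fun u => x u i) t (g t (x t) i))].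
    - intros t Ht Hlt. destruct (Hsn (t + sigma)) as [n Hn]; [lra|].
      apply (Ht n). specialize (Hn n ltac:(lia)). lra.
    - intros n. destruct (P1 (s n) (Hs n)) as (J & z & (I1 & I2 & I3 & I4 & I5) & H2 & H3).
      eapply ae_impl; [|exact I5]. intros t Ht Hlt i.
      apply derivable_pt_lim_ext_loc with (F := fun u => z u i) (a := s n) (b := 0); [|easy|].
      + intros r Hr. now rewrite H3 by lra.
      + rewrite <- (H3 t) by lra. apply Ht. apply (I1 (s n) t 0); auto. lra. }
  destruct (HLC (ball c) (compact_ball c)) as (m & l & Hm & _ & Hml).
  assert (P4 : ae (fun t => - sigma < t < 0 ->
     (forall i, derivable_pt_lim (fun u => x u i) t (g t (x t) i)) /\ vnorm (g t (x t)) <= m t)).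
  { eapply ae_impl; [|apply (ae_and _ _ P3 Hml)]. intros t [H1 H2] Ht. split; [auto|].
    assert (ball c (x t)) by (apply Hx; lra). now apply (H2 (x t) (x t)). }
  assert (P5 : forall eps, 0 < eps -> exists del, 0 < del /\
     forall (n : nat) (u w : nat -> R),
      (forall k, (k <= n)%nat -> - sigma < u k /\ u k <= w k /\ w k <= 0) ->
      (forall k, (k < n)%nat -> w k <= u (S k)) ->
      sum_f_R0 (fun k => w k - u k) n < del ->
      sum_f_R0 (fun k => vnorm (vsub (x (w k)) (x (u k)))) n < eps).
  { intros eps He.
    destruct (uniform_AC_of_derivative_bound m (- sigma) 0 eps Hm) as [del [Hdel H]]; [lra|easy|].
    exists del. split; [easy|]. intros n u w Huw Ho Hsum.
    destruct (Huw 0%nat) as [Hu0 _]; [lia|].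
    apply (H N x (fun t => g t (x t)) (u 0%nat) 0); auto; try lra.
    - apply P2; lra.
    - eapply ae_impl; [|apply (ae_and _ _ P4 (ae_neq 0))]. intros t [H1 H2] Ht. apply H1. lra.
    - intros k Hk. destruct (Huw k Hk) as (H1 & H2 & H3). repeat split; auto.
      clear H1 H2 H3. induction k as [|k IH]; [lra|].
      specialize (IH ltac:(lia)). specialize (Ho k ltac:(lia)). specialize (Huw k ltac:(lia)). lra. }
  (* Compactness yields only a cluster point at [- sigma]; the uniform modulus [P5] makes it a limit
     in [P6]. *)
  destruct (bounded_seq_cluster (fun n => x (s n)) c 0) as [z Hz].
  { intros n _. apply Hx, Hs. }
  assert (P6 : forall eps, 0 < eps -> exists rho, 0 < rho /\
            forall t, - sigma < t < - sigma + rho -> t <= 0 -> vnorm (vsub (x t) z) < eps).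
  { intros eps He. destruct (P5 (eps / 2)) as [del [Hdel H]]; [lra|].
    exists del. split; [easy|]. intros t Ht Ht0.
    destruct (Hsn del Hdel) as [n0 Hn0]. destruct (Hz (eps / 2) n0) as [n [Hn Hzn]]; [lra|].
    specialize (Hn0 n Hn). specialize (Hs n).
    pose proof (vnorm_sub_triangle (x (s n)) (x t) z).
    assert (vnorm (vsub (x t) (x (s n))) < eps / 2); [|lra].
    destruct (Rle_dec t (s n)).
    - rewrite vnorm_sub_sym.
      apply (H 0%nat (fun _ => t) (fun _ => s n)); simpl; intros; [lra|lia|lra].
    - apply (H 0%nat (fun _ => s n) (fun _ => t)); simpl; intros; [lra|lia|lra]. }
  set (x' := fun t => if Req_dec_T t (- sigma) then z else x t).
  assert (Hx'1 : forall t, t <> - sigma -> x' t = x t).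
  { intros t Ht. unfold x'. now destruct (Req_dec_T t (- sigma)). }
  assert (Hx'0 : x' (- sigma) = z).
  { unfold x'. now destruct (Req_dec_T (- sigma) (- sigma)). }
  assert (P7 : AC x' (- sigma) 0).
  { intros eps He. destruct (P5 (eps / 2)) as [del [Hdel H]]; [lra|].
    exists del. split; [easy|]. intros n u w Huw Ho Hsum.
    pose proof (pos_INR n).
    (* [e] may depend on the number of intervals because [del] is already fixed: each of the [n + 1]
       terms changes by at most [4 * e], in total by [eps / 2]. *)
    set (e := eps / 2 / (INR n + 1) / 4).
    assert (Hepos : 0 < e) by (unfold e; repeat apply Rdiv_lt_0_compat; lra).
    destruct (P6 e Hepos) as [rho [Hrho Hxz]].
    set (theta := Rmin (rho / 2) sigma).
    assert (Ht1 : theta <= rho / 2) by apply Rmin_l.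
    assert (Ht2 : theta <= sigma) by apply Rmin_r.
    assert (Ht3 : 0 < theta) by (apply Rmin_glb_lt; lra).
    (* pushing the left endpoint into the interior changes each value by at most [2 e] *)
    set (phi := fun t => Rmax t (- sigma + theta)).
    assert (Hphi : forall a b, a <= b -> phi a <= phi b /\ phi b - phi a <= b - a).
    { intros a b Hab. unfold phi, Rmax. destruct (Rle_dec a _), (Rle_dec b _); lra. }
    assert (Hphi0 : forall a, - sigma <= a <= 0 -> - sigma < phi a <= 0).
    { intros a Ha. unfold phi, Rmax. destruct (Rle_dec a _); lra. }
    assert (Hclose : forall a, - sigma <= a <= 0 -> vnorm (vsub (x' a) (x (phi a))) <= 2 * e).
    { intros a Ha.
      assert (Hth := Hxz (- sigma + theta) ltac:(lra) ltac:(lra)). rewrite vnorm_sub_sym in Hth.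
      unfold phi, Rmax. destruct (Rle_dec a _) as [Hle|Hgt].
      - pose proof (vnorm_sub_triangle z (x' a) (x (- sigma + theta))) as Htri.
        destruct (Req_dec a (- sigma)) as [->|Hne].
        + rewrite Hx'0 in *. lra.
        + rewrite (Hx'1 a Hne) in *. assert (vnorm (vsub (x a) z) < e) by (apply Hxz; lra). lra.
      - rewrite Hx'1 by lra. rewrite vnorm_sub_self. lra. }
    apply Rle_lt_trans with
      (sum_f_R0 (fun k => vnorm (vsub (x (phi (w k))) (x (phi (u k)))) + 4 * e) n).
    - apply sum_Rle. intros k Hk. destruct (Huw k Hk) as (H1 & H2 & H3).
      assert (C1 := Hclose (w k) ltac:(lra)). assert (C2 := Hclose (u k) ltac:(lra)).
      rewrite vnorm_sub_sym in C2.
      pose proof (vnorm_sub_triangle (x (phi (w k))) (x' (w k)) (x' (u k))).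
      pose proof (vnorm_sub_triangle (x (phi (u k))) (x (phi (w k))) (x' (u k))). lra.
    - rewrite sum_plus, sum_cte, S_INR.
      assert (4 * e * (INR n + 1) = eps / 2) by (unfold e; field; lra).
      assert (sum_f_R0 (fun k => vnorm (vsub (x (phi (w k))) (x (phi (u k))))) n < eps / 2); [|lra].
      apply (H n (fun k => phi (u k)) (fun k => phi (w k))).
      + intros k Hk. destruct (Huw k Hk) as (I1 & I2 & I3).
        destruct (Hphi0 (u k)); [lra|]. destruct (Hphi0 (w k)); [lra|].
        destruct (Hphi (u k) (w k)); [lra|]. lra.
      + intros k Hk. apply Hphi. auto.
      + eapply Rle_lt_trans; [|exact Hsum]. apply sum_Rle. intros k Hk. apply Hphi.
        apply Huw; auto. }
  exists z. exists (fun t => - sigma <= t <= 0), x'. split; [|split; [lra|easy]].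
  split; [|split; [|split; [|split]]].
  - intros a b d Ha Hd Hb. lra.
  - lra.
  - rewrite Hx'1 by lra. apply (Huniq 0); [apply Hx; lra|apply sol_val_refl].
  - intros a b Ha Hb _. apply AC_sub with (- sigma) 0; [lra|lra|exact P7].
  - eapply ae_impl; [|apply (ae_and _ _ P4 (ae_and _ _ (ae_neq 0) (ae_neq (- sigma))))].
    intros t (H1 & H2 & H3) Ht i.
    apply derivable_pt_lim_ext_loc with (F := fun u => x u i) (a := - sigma) (b := 0); [|lra|].
    + intros r Hr. now rewrite Hx'1 by lra.
    + rewrite Hx'1 by easy. apply H1. lra.
Qed.

(** * The skew-product flow on the hull *)

Definition forward_complete_hull {N} (T : (LCF N -> Prop) -> Prop) (f : LCF N) : Prop :=
  LC f /\ topology_on T /\ skew_cont T f /\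
  (forall g, ((exists s, 0 <= s /\ g = shift f s) \/ Omega T f g) ->
     forall x0, exists x, sol g 0 x0 (fun t => 0 <= t) x).

Lemma forward_val {N} (T : (LCF N -> Prop) -> Prop) f g :
  forward_complete_hull T f -> ((exists s, 0 <= s /\ g = shift f s) \/ Omega T f g) ->
  forall x0 t, 0 <= t -> exists v, sol_val g 0 x0 t v.
Proof.
  intros (_ & _ & _ & H) Hg x0 t Ht. destruct (H g Hg x0) as [x Hx].
  exists (x t), (fun t => 0 <= t), x. auto.
Qed.

(** The flow keeps translates in the hull, in particular in [LC], at times that some solution
    reaches; forward completeness supplies such a solution for [0 <= t]. *)
Lemma Hull_shift {N} (T : (LCF N -> Prop) -> Prop) f t :
  forward_complete_hull T f -> 0 <= t -> Hull T f (shift f t).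
Proof.
  intros Hstd Ht. pose proof Hstd as (HLC & _ & (Hdef & _) & _).
  destruct (forward_val T f f Hstd) with (x0 := fun _ : Fin.t N => 0) (t := t) as [v Hv].
  - left. exists 0. split; [lra|]. now rewrite shift_0.
  - easy.
  - apply Hdef with (x0 := fun _ => 0). split; [|now exists v].
    split; [easy|]. intros U _ HU. exists 0. now rewrite shift_0.
Qed.

Lemma Omega_Hull {N} (T : (LCF N -> Prop) -> Prop) f g : Omega T f g -> Hull T f g.
Proof.
  intros (HLC & tn & _ & _ & Hc). split; [easy|]. intros U HU Ug.
  destruct (Hc U HU Ug) as [n0 Hn]. exists (tn n0). now apply Hn.
Qed.

(** With time held fixed, openness of the domain makes nearby solutions reach [t], so the continuity
    clause applies to them. *)
Lemma flow_continuity {N} (T : (LCF N -> Prop) -> Prop) f h x0 t v U eps :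
  forward_complete_hull T f -> Hull T f h -> sol_val h 0 x0 t v ->
  T U -> U (shift h t) -> 0 < eps ->
  exists d V, 0 < d /\ T V /\ V h /\ forall h' x0', V h' -> Hull T f h' ->
    vnorm (vsub x0' x0) < d -> U (shift h' t) /\ (exists v', sol_val h' 0 x0' t v') /\
    forall v', sol_val h' 0 x0' t v' -> vnorm (vsub v' v) < eps.
Proof.
  intros (_ & HT & (Hdef & Hopen & Hcont) & _) Hh Hv TU HU He.
  destruct HT as (_ & _ & _ & HI & _).
  assert (Hdom : skew_dom T f t h x0) by (split; [easy|now exists v]).
  destruct (Hopen t h x0 Hdom) as (d1 & V1 & Hd1 & TV1 & V1h & H1).
  destruct (Hcont t h x0 Hdom U eps TU HU He) as (d2 & V2 & Hd2 & TV2 & V2h & H2).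
  exists (Rmin d1 d2), (fun h' => V1 h' /\ V2 h').
  split; [now apply Rmin_glb_lt|]. split; [auto|]. split; [easy|].
  intros h' x0' [W1 W2] Hh' Hx.
  pose proof (Rmin_l d1 d2). pose proof (Rmin_r d1 d2).
  assert (Ht1 : Rabs (t - t) < d1) by (rewrite Rminus_diag, Rabs_R0; lra).
  assert (Ht2 : Rabs (t - t) < d2) by (rewrite Rminus_diag, Rabs_R0; lra).
  assert (D' : skew_dom T f t h' x0') by (apply H1; auto; lra).
  destruct (H2 t h' x0') as [HU' Hc]; auto; [lra|].
  split; [easy|]. split; [apply D'|]. intros v' Hv'. now apply Hc.
Qed.

Lemma flow_value_continuity {N} (T : (LCF N -> Prop) -> Prop) f h x0 t v eps :
  forward_complete_hull T f -> Hull T f h -> sol_val h 0 x0 t v -> 0 < eps ->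
  exists d V, 0 < d /\ T V /\ V h /\ forall h' x0', V h' -> Hull T f h' ->
    vnorm (vsub x0' x0) < d -> (exists v', sol_val h' 0 x0' t v') /\
    forall v', sol_val h' 0 x0' t v' -> vnorm (vsub v' v) < eps.
Proof.
  intros Hstd Hh Hv He. pose proof Hstd as (_ & (TLC & _) & (Hdef & _) & _).
  destruct (flow_continuity T f h x0 t v _ eps Hstd Hh Hv TLC) as (d & V & Hd & TV & Vh & H); auto.
  - apply Hdef with (x0 := x0). split; [easy|now exists v].
  - exists d, V. repeat split; auto; now apply H.
Qed.

(* Continuity at a point compares all values of the flow there, so it forces uniqueness. *)
Lemma sol_val_unique0 {N} (T : (LCF N -> Prop) -> Prop) f h x0 t v v' :
  forward_complete_hull T f -> Hull T f h ->
  sol_val h 0 x0 t v -> sol_val h 0 x0 t v' -> v = v'.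
Proof.
  intros Hstd Hh Hv Hv'. apply vnorm_sub_eq. intros eps He.
  destruct (flow_value_continuity T f h x0 t v' eps) as (d & V & Hd & _ & Vh & H); auto.
  apply (H h x0); auto. now rewrite vnorm_sub_self.
Qed.

Lemma monotone_seq_le (u : nat -> R) n m :
  (forall n, u n <= u (S n)) -> (n <= m)%nat -> u n <= u m.
Proof. intros H Hnm. induction Hnm; [lra|]. specialize (H m). lra. Qed.

Lemma Omega_shift_of_sol {N} (T : (LCF N -> Prop) -> Prop) f g x0 t v :
  forward_complete_hull T f -> Omega T f g -> sol_val g 0 x0 t v -> Omega T f (shift g t).
Proof.
  intros Hstd Hg Hv. pose proof (Omega_Hull _ _ _ Hg) as Hh.
  assert (Hgt : Hull T f (shift g t)).
  { pose proof Hstd as (_ & _ & (Hdef & _) & _). apply Hdef with (x0 := x0).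
    split; [easy|now exists v]. }
  destruct Hg as (_ & tn & Hmono & Hinf & Hc).
  split; [apply Hgt|]. exists (fun n => tn n + t). split; [intros n; specialize (Hmono n); lra|].
  split.
  - intros M. destruct (Hinf (M - t)) as [n Hn]. exists n. lra.
  - intros U TU HU.
    destruct (flow_continuity T f g x0 t v U 1) as (d & V & Hd & TV & Vg & H); auto; [lra|].
    (* From [n2] on [tn n] is positive, a range in which the translates of [f] are known to lie in
       the hull. *)
    destruct (Hc V TV Vg) as [n1 Hn1]. destruct (Hinf 0) as [n2 Hn2].
    exists (Nat.max n1 n2). intros n Hn. rewrite <- shift_shift.
    assert (tn n2 <= tn n) by (apply monotone_seq_le; [easy|lia]).
    apply (H (shift f (tn n)) x0).
    + apply Hn1. lia.
    + apply Hull_shift; [easy|lra].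
    + now rewrite vnorm_sub_self.
Qed.

(* [y] is a cluster point at time 0 of solutions of [f_{t_n}] started from the origin so early
   that they are bounded by the ultimate bound of [f] on all of [-L, 0]. *)
Lemma Omega_backward_sol {N} (T : (LCF N -> Prop) -> Prop) f g tau L :
  forward_complete_hull T f -> UUB_on f tau -> Omega T f g -> 0 < L ->
  exists y v, sol_val g 0 y (- L) v.
Proof.
  intros Hstd (c & Hc & HB) Hg HL.
  destruct (HB 1) as (T0 & HT0 & HB1); [lra|]. clear HB.
  pose proof (Omega_Hull _ _ _ Hg) as Hh.
  destruct Hg as (HLC & tn & Hmono & Hinf & Hconv).
  (* The start lies [T0] before [- L], so that the bound holds from [- L] on. In the time of [f] it
     must come after [tau] for the ultimate bound and after 0 for forward existence. *)
  destruct (Hinf (Rmax tau 0 + (L + T0))) as [n0 Hn0].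
  assert (Htn : forall n, (n0 <= n)%nat -> tau <= tn n - (L + T0) /\ 0 <= tn n - (L + T0)).
  { intros n Hn. assert (tn n0 <= tn n) by (apply monotone_seq_le; auto).
    pose proof (Rmax_l tau 0). pose proof (Rmax_r tau 0). lra. }
  destruct (choice_fun (fun n X => (n0 <= n)%nat ->
     sol (shift f (tn n)) (- (L + T0)) (fun _ : Fin.t N => 0) (fun t => 0 <= t + (L + T0)) X))
    as [X HX].
  { intros n. destruct (le_dec n0 n) as [Hn|Hn]; [|exists (fun _ _ => 0); easy].
    destruct (Htn n Hn) as [_ Hr].
    pose proof Hstd as (_ & _ & _ & Hex).
    destruct (Hex (shift f (tn n - (L + T0)))) with (x0 := fun _ : Fin.t N => 0) as [xi Hxi].
    { left. eauto. }
    apply (sol_shift _ _ _ _ _ (L + T0)) in Hxi. rewrite shift_shift in Hxi.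
    replace (tn n - (L + T0) + (L + T0)) with (tn n) in Hxi by ring.
    rewrite Rminus_0_l in Hxi. eexists. intros _. exact Hxi. }
  assert (HXb : forall n t, (n0 <= n)%nat -> - L <= t -> vnorm (X n t) <= c).
  { intros n t Hn Ht. destruct (Htn n Hn) as [Hr _].
    apply (HB1 (tn n - (L + T0)) (t + (L + T0)) (fun _ => 0)); [easy|lra|rewrite vnorm_zero; lra|].
    replace (t + (L + T0) + (tn n - (L + T0))) with (t + tn n) by ring.
    replace (tn n - (L + T0)) with (- (L + T0) + tn n) by ring.
    apply sol_val_unshift. do 2 eexists. split; [apply (HX n Hn)|]. split; [lra|easy]. }
  assert (HX0 : forall n t, (n0 <= n)%nat -> - L <= t ->
                sol_val (shift f (tn n)) 0 (X n 0) t (X n t)).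
  { intros n t Hn Ht. destruct (HX n Hn) as (H1 & H2 & H3 & H4 & H5).
    exists (fun t => 0 <= t + (L + T0)), (X n). repeat split; auto; lra. }
  destruct (bounded_seq_cluster (fun n => X n 0) c n0) as [y Hy].
  { intros n Hn. apply HXb; [easy|lra]. }
  exists y.
  (* Continuity at [(t, g, y)] approximates the value of [g] by values [X n t], which obey the bound
     [c]. *)
  assert (Hbd : forall t v, - L <= t -> sol_val g 0 y t v -> vnorm v <= c).
  { intros t v Ht Hv. apply le_epsilon. intros e He.
    destruct (flow_value_continuity T f g y t v e) as (d & V & Hd & TV & Vg & H); auto.
    destruct (Hconv V TV Vg) as [n1 Hn1].
    destruct (Hy d (Nat.max n0 n1) Hd) as [n [Hn Hyn]].
    destruct (H (shift f (tn n)) (X n 0)) as [_ H'].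
    - apply Hn1. lia.
    - apply Hull_shift; [easy|]. destruct (Htn n); [lia|lra].
    - easy.
    - specialize (H' _ (HX0 n t ltac:(lia) Ht)).
      assert (vnorm (X n t) <= c) by (apply HXb; [lia|easy]).
      pose proof (vnorm_le_sub v (X n t)). rewrite vnorm_sub_sym in H'. lra. }
  (* The supremum of the backward times reached is itself reached, the solution being bounded by
     [c]. Were it below [L], openness of the domain in time would allow a further step. *)
  set (E := fun s => 0 <= s <= L /\ exists v, sol_val g 0 y (- s) v).
  assert (E0 : E 0).
  { split; [lra|]. exists y. rewrite Ropp_0. apply sol_val_refl. }
  destruct (completeness E) as [s [Hub Hlub]].
  { exists L. intros r [Hr _]. lra. }
  { exists 0. exact E0. }
  assert (Hs0 : 0 <= s) by (apply Hub; exact E0).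
  assert (HsL : s <= L) by (apply Hlub; intros r [Hr _]; lra).
  assert (Es : exists v, sol_val g 0 y (- s) v).
  { destruct (Req_dec s 0) as [->|Hne]; [apply E0|].
    apply bounded_solution_reaches_endpoint with c; [easy|lra| |].
    - intros t v v'. now apply sol_val_unique0 with T f.
    - intros t Ht.
      assert (Hex : exists r, E r /\ - t < r).
      { apply NNPP. intros Hn. assert (s <= - t); [|lra].
        apply Hlub. intros r Er. destruct (Rle_dec r (- t)); [easy|].
        exfalso. apply Hn. exists r. split; [easy|lra]. }
      destruct Hex as [r [[Hr [v Hv]] Hlt]].
      destruct (sol_val_mid g 0 y (- r) v t) as [z [Hz _]].
      { rewrite Rmin_right, Rmax_left; lra. }
      { easy. }
      exists z. split; [easy|]. apply (Hbd t); [lra|easy]. }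
  assert (HE : E s) by now split.
  destruct (Rle_lt_or_eq_dec s L HsL) as [Hlt|Heq]; [exfalso|now rewrite <- Heq].
  destruct HE as [_ [v Hv]].
  pose proof Hstd as (_ & _ & (_ & Hopen & _) & _).
  destruct (Hopen (- s) g y) as (d & V & Hd & TV & Vg & H).
  { split; [easy|now exists v]. }
  set (r := Rmin L (s + d / 2)).
  assert (Hr1 : r <= L) by apply Rmin_l. assert (Hr2 : r <= s + d / 2) by apply Rmin_r.
  assert (Hr3 : s < r) by (apply Rmin_glb_lt; lra).
  assert (Er : E r).
  { split; [lra|]. apply (H (- r) g y); auto.
    - rewrite Rabs_left; lra.
    - now rewrite vnorm_sub_self. }
  apply Hub in Er. lra.
Qed.

Lemma Omega_shift {N} (T : (LCF N -> Prop) -> Prop) f g tau t :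
  forward_complete_hull T f -> UUB_on f tau -> Omega T f g -> Omega T f (shift g t).
Proof.
  intros Hstd HU Hg. destruct (Rle_dec 0 t) as [Ht|Ht].
  - destruct (forward_val T f g Hstd (or_intror Hg) (fun _ => 0) t Ht) as [v Hv].
    now apply Omega_shift_of_sol with (fun _ => 0) v.
  - destruct (Omega_backward_sol T f g tau (- t)) as (y & v & Hv); auto; [lra|].
    rewrite Ropp_involutive in Hv. now apply Omega_shift_of_sol with y v.
Qed.

Lemma Omega_UUB {N} (T : (LCF N -> Prop) -> Prop) f g tau :
  forward_complete_hull T f -> UUB_on f tau -> Omega T f g -> UUB g.
Proof.
  intros Hstd HU Hg. pose proof HU as (c & Hc & HB). exists c. split; [easy|].
  intros d Hd. destruct (HB d Hd) as (T0 & HT0 & HB0). exists T0. split; [easy|].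
  intros r t x0 v Ht Hx0 Hv.
  (* Moving the start to time 0 replaces [g] by another member of the omega-limit set. Each member
     is a limit of translates of [f] by times past [tau], so the same [T0] serves all [r]. *)
  assert (Hgr : Omega T f (shift g r)) by now apply Omega_shift with tau.
  apply (sol_val_shift _ _ _ _ _ r) in Hv.
  replace (r - r) with 0 in Hv by ring. replace (t + r - r) with t in Hv by ring.
  apply le_epsilon. intros e He.
  destruct (flow_value_continuity T f (shift g r) x0 t v e) as (d' & V & Hd' & TV & Vg & H); auto.
  { now apply Omega_Hull. }
  destruct Hgr as (_ & tn & Hmono & Hinf & Hconv).
  destruct (Hconv V TV Vg) as [n1 Hn1]. destruct (Hinf (Rmax tau 0)) as [n2 Hn2].
  pose proof (Rmax_l tau 0). pose proof (Rmax_r tau 0).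
  set (n := Nat.max n1 n2).
  assert (tn n2 <= tn n) by (apply monotone_seq_le; [easy|lia]).
  destruct (H (shift f (tn n)) x0) as [[v' Hv'] H'].
  - apply Hn1. lia.
  - apply Hull_shift; [easy|lra].
  - now rewrite vnorm_sub_self.
  - specialize (H' v' Hv'). apply sol_val_unshift in Hv'. rewrite Rplus_0_l in Hv'.
    assert (vnorm v' <= c) by (apply (HB0 (tn n) t x0); auto; lra).
    pose proof (vnorm_le_sub v v'). rewrite vnorm_sub_sym in H'. lra.
Qed.

(** * The pullback attractor *)

Definition process_unique {N} (g : LCF N) : Prop :=
  forall s x0 t v v', sol_val g s x0 t v -> sol_val g s x0 t v' -> v = v'.

Definition process_continuous {N} (g : LCF N) : Prop :=
  forall s x0 t v eps, sol_val g s x0 t v -> 0 < eps ->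
  exists d, 0 < d /\ forall x0' v', vnorm (vsub x0' x0) < d -> sol_val g s x0' t v' ->
    vnorm (vsub v' v) < eps.

Lemma process_val {N} (g : LCF N) s x0 t :
  process_defined g -> s <= t -> exists v, sol_val g s x0 t v.
Proof.
  intros H Hst. destruct (H s x0) as [x Hx]. exists (x t), (fun t => s <= t), x. auto.
Qed.

Lemma process_split {N} (g : LCF N) s r t x0 v :
  s <= r -> r <= t -> sol_val g s x0 t v ->
  exists z, sol_val g s x0 r z /\ sol_val g r z t v.
Proof.
  intros Hsr Hrt. apply sol_val_mid. rewrite Rmin_left, Rmax_right; lra.
Qed.

(** No solutions are glued: the solution from [s] that exists up to [t] is cut at [r], and
    uniqueness identifies both pieces. *)
Lemma process_comp {N} (g : LCF N) s r t x0 z v :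
  process_defined g -> process_unique g -> s <= r -> r <= t ->
  sol_val g s x0 r z -> sol_val g r z t v -> sol_val g s x0 t v.
Proof.
  intros Hdef Hu Hsr Hrt H1 H2.
  destruct (process_val g s x0 t Hdef) as [v' Hv']; [lra|].
  destruct (process_split g s r t x0 v' Hsr Hrt Hv') as (z' & H3 & H4).
  rewrite (Hu _ _ _ _ _ H3 H1) in H4. now rewrite (Hu _ _ _ _ _ H2 H4).
Qed.

Definition pullback_limit {N} (g : LCF N) (c : R) (t : R) (y : vec N) : Prop :=
  forall eps s0, 0 < eps -> exists s x0 y', s <= s0 /\ vnorm x0 <= c /\
    sol_val g s x0 t y' /\ vnorm (vsub y' y) < eps.

(* It suffices to start in arbitrary bounded sets: they enter the absorbing ball before [s0]. *)
Lemma pullback_limit_intro {N} (g : LCF N) c d t y :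
  (forall d, 0 < d -> exists T0, 0 < T0 /\ forall r t x0 v, T0 <= t -> vnorm x0 <= d ->
      sol_val g r x0 (t + r) v -> vnorm v <= c) ->
  (forall eps s0, 0 < eps -> exists s x0 y', s <= s0 /\ vnorm x0 <= d /\
    sol_val g s x0 t y' /\ vnorm (vsub y' y) < eps) ->
  pullback_limit g c t y.
Proof.
  intros HB H eps s0 He.
  destruct (HB (Rabs d + 1)) as (T0 & HT0 & HB0); [pose proof (Rabs_pos d); lra|].
  set (r := Rmin s0 t). assert (r <= s0) by apply Rmin_l. assert (r <= t) by apply Rmin_r.
  destruct (H eps (r - T0) He) as (s & x0 & y' & Hs & Hx0 & Hy' & Hc).
  destruct (process_split g s r t x0 y') as (z & Hz & Hv); auto; [lra|].
  exists r, z, y'. repeat split; auto.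
  apply (HB0 s (r - s) x0); [lra|pose proof (RRle_abs d); lra|].
  now replace (r - s + s) with r by ring.
Qed.

(** Cluster points of orbits started ever earlier give attraction and the preimages for invariance;
    they exist because the ultimate bound brings the orbits into the ball of radius [c]. Minimality
    holds since a closed attracting family attracts this ball. *)
Lemma pullback_attractor_exists {N} (g : LCF N) :
  process_defined g -> process_unique g -> process_continuous g -> UUB g ->
  exists A, pullback_attractor g A /\ bounded_family A.
Proof.
  intros Hdef Hu Hcont (c & Hc & HB). exists (pullback_limit g c).
  assert (Habs : forall d, 0 < d -> exists T0, 0 < T0 /\ forall s t x0 v, s <= t - T0 ->
             vnorm x0 <= d -> sol_val g s x0 t v -> vnorm v <= c).
  { intros d Hd. destruct (HB d Hd) as (T0 & HT0 & H). exists T0. split; [easy|].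
    intros s t x0 v Hs Hx Hv. apply (H s (t - s) x0); [lra|easy|].
    now replace (t - s + s) with t by ring. }
  assert (Hball : forall t y, pullback_limit g c t y -> vnorm y <= c).
  { intros t y Hy. apply le_epsilon. intros e He. destruct (Habs c Hc) as (T0 & HT0 & H).
    destruct (Hy e (t - T0) He) as (s & x0 & y' & Hs & Hx0 & Hy' & Hc').
    assert (vnorm y' <= c) by now apply (H s t x0).
    pose proof (vnorm_le_sub y y'). rewrite vnorm_sub_sym in Hc'. lra. }
  split; [|now exists c].
  split; [|split; [|split]].
  - intros t. apply compact_closed_bounded; [|exists c; apply Hball].
    intros y Hy. apply NNPP. intros Hn. apply Hy. intros eps s0 He.
    apply NNPP. intros Hn'. apply Hn. exists (eps / 2). split; [lra|].
    intros z Hz HA. apply Hn'.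
    destruct (HA (eps / 2) s0) as (s & x0 & y' & Hs & Hx0 & Hy' & Hc'); [lra|].
    exists s, x0, y'. repeat split; auto. pose proof (vnorm_sub_triangle z y' y). lra.
  - intros t s Hst y. split.
    + intros Hy.
      (* Starting before [s - T0] puts the intermediate values at time [s] into the ball; their
         cluster point is the sought preimage of [y]. *)
      destruct (Habs c Hc) as (T0 & HT0 & HT).
      assert (Hseq : forall n : nat, exists q : R * vec N * vec N * vec N,
        let '(r, x0, z, y') := q in r <= s - T0 - INR n /\ vnorm x0 <= c /\
          sol_val g r x0 s z /\ sol_val g s z t y' /\ vnorm (vsub y' y) < / (INR n + 1)).
      { intros n. pose proof (pos_INR n).
        destruct (Hy (/ (INR n + 1)) (s - T0 - INR n)) as (r & x0 & y' & Hr & Hx0 & Hy' & Hc').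
        { apply Rinv_0_lt_compat. lra. }
        destruct (process_split g r s t x0 y') as (z & H1 & H2); auto; [lra|].
        exists (r, x0, z, y'). auto. }
      destruct (choice_fun _ Hseq) as [q Hq]. clear Hseq.
      destruct (bounded_seq_cluster (fun n => snd (fst (q n))) c 0) as [z Hz].
      { intros n _. specialize (Hq n). destruct (q n) as [[[r x0] z] y'].
        destruct Hq as (H1 & H2 & H3 & _). simpl. apply (HT r s x0); auto.
        pose proof (pos_INR n). lra. }
      exists z. split.
      * intros eps s0 He. destruct (INR_unbounded (s - T0 - s0)) as [n1 Hn1].
        destruct (Hz eps n1 He) as [n [Hn Hzn]]. apply le_INR in Hn.
        specialize (Hq n). destruct (q n) as [[[r x0] z'] y']. simpl in Hzn.
        destruct Hq as (H1 & H2 & H3 & H4 & H5). exists r, x0, z'. repeat split; auto. lra.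
      * destruct (process_val g s z t Hdef Hst) as [v Hv].
        (* The values [y'] approach [y] by their choice and come close to [v] by continuity at
           [z]. *)
        replace y with v; [easy|]. apply vnorm_sub_eq. intros e He.
        destruct (Hcont s z t v (e / 2) Hv) as (d & Hd & Hcd); [lra|].
        destruct (INR_unbounded (2 / e)) as [n1 Hn1].
        destruct (Hz d n1 Hd) as [n [Hn Hzn]]. apply le_INR in Hn.
        specialize (Hq n). destruct (q n) as [[[r x0] z'] y']. simpl in Hzn.
        destruct Hq as (H1 & H2 & H3 & H4 & H5).
        specialize (Hcd z' y' Hzn H4). rewrite vnorm_sub_sym in Hcd.
        pose proof (vnorm_sub_triangle y' v y).
        assert (/ (INR n + 1) < e / 2); [|lra].
        pose proof (pos_INR n).
        apply Rmult_lt_reg_r with (INR n + 1); [lra|]. rewrite Rinv_l by lra.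
        assert (2 / e * e = 2) by (field; lra). nra.
    + intros (x0 & Hx0 & Hv) eps s0 He.
      destruct (Hcont s x0 t y eps Hv He) as (d & Hd & Hcd).
      destruct (Hx0 d (Rmin s s0) Hd) as (r & p & z & Hr & Hp & Hz & Hc').
      pose proof (Rmin_l s s0). pose proof (Rmin_r s s0).
      destruct (process_val g s z t Hdef Hst) as [v Hv'].
      exists r, p, v. repeat split; auto; [lra| |now apply (Hcd z)].
      apply process_comp with s z; auto. lra.
  - intros D t [B HD] eps He. apply NNPP. intros Hn.
    destruct (Habs (Rabs B + 1)) as (T0 & HT0 & HT); [pose proof (Rabs_pos B); lra|].
    (* Failure of attraction yields values farther than [eps] from the whole limit set, with start
       times tending to minus infinity; yet their cluster point belongs to that set. *)
    assert (Hseq : forall n : nat, exists q : R * vec N * vec N,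
      let '(s, x0, y) := q in s <= t - T0 - INR n /\ vnorm x0 <= Rabs B + 1 /\ sol_val g s x0 t y /\
        forall a, pullback_limit g c t a -> ~ vnorm (vsub y a) <= eps).
    { intros n. apply NNPP. intros Hn'. apply Hn. exists (t - T0 - INR n).
      split; [pose proof (pos_INR n); lra|]. intros s x0 y Hs Hx0 Hy. apply NNPP. intros Hn2.
      apply Hn'. exists (s, x0, y). split; [easy|]. split.
      { specialize (HD x0 Hx0). pose proof (RRle_abs B). lra. }
      split; [easy|]. intros a Ha Hle. apply Hn2. now exists a. }
    destruct (choice_fun _ Hseq) as [q Hq]. clear Hseq.
    destruct (bounded_seq_cluster (fun n => snd (q n)) c 0) as [y Hy].
    { intros n _. specialize (Hq n). destruct (q n) as [[s x0] y].
      destruct Hq as (H1 & H2 & H3 & _). simpl. apply (HT s t x0); auto.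
      pose proof (pos_INR n). lra. }
    assert (Hlim : pullback_limit g c t y).
    { apply pullback_limit_intro with (Rabs B + 1); [exact HB|]. intros e s0 He'.
      destruct (INR_unbounded (t - T0 - s0)) as [n1 Hn1].
      destruct (Hy e n1 He') as [n [Hle Hyn]]. apply le_INR in Hle.
      specialize (Hq n). destruct (q n) as [[s x0] y']. simpl in Hyn.
      destruct Hq as (H1 & H2 & H3 & _). exists s, x0, y'. repeat split; auto. lra. }
    destruct (Hy eps 0%nat He) as [n [_ Hyn]].
    specialize (Hq n). destruct (q n) as [[s x0] y']. simpl in Hyn.
    destruct Hq as (_ & _ & _ & H4). apply (H4 y Hlim). lra.
  - intros C HC Hatt t y Hy. apply NNPP. intros Hn.
    destruct (HC t y Hn) as (d & Hd & Hout).
    (* Two approximations within [d / 3] place a point of [C t] inside the ball of radius [d] around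
       [y], which misses [C t]. *)
    destruct (Hatt (ball c) t) with (eps := d / 3) as (s0 & _ & Hs0); [now exists c|lra|].
    destruct (Hy (d / 3) s0) as (s & x0 & y' & Hs & Hx0 & Hy' & Hc'); [lra|].
    destruct (Hs0 s x0 y' Hs Hx0 Hy') as (a & Ha & Hya).
    apply (Hout a); [|easy].
    pose proof (vnorm_sub_triangle y' a y). rewrite (vnorm_sub_sym a y') in *. lra.
Qed.

Theorem theorem5p9 (N : nat) (f : LCF N) (T : (LCF N -> Prop) -> Prop) :
  LC f ->
  topology_on T ->
  skew_cont T f ->
  (forall g, ((exists s, 0 <= s /\ g = shift f s) \/ Omega T f g) ->
     forall x0, exists x, sol g 0 x0 (fun t => 0 <= t) x) ->
  (exists tau, UUB_on f tau) ->
  forall g, Omega T f g ->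
    process_defined g /\ UUB g /\
    exists A, pullback_attractor g A /\ bounded_family A.
Proof.
  intros HLC HT Hskew Hfwd [tau HU] g Hg.
  assert (Hstd : forward_complete_hull T f) by (split; [|split; [|split]]; assumption).
  assert (Hsh : forall s, Omega T f (shift g s)) by (intros s; now apply Omega_shift with tau).
  assert (Hto0 : forall s x0 t v, sol_val g s x0 t v -> sol_val (shift g s) 0 x0 (t - s) v).
  { intros s x0 t v H. apply (sol_val_shift _ _ _ _ _ s) in H. now rewrite Rminus_diag in H. }
  (* A solution of [g] from time [s] on is a translate of a forward solution of [shift g s], which
     is again in the omega-limit set and hence forward complete. *)
  assert (Hdef : process_defined g).
  { intros s x0. destruct (Hfwd (shift g s) (or_intror (Hsh s)) x0) as [x Hx].
    apply (sol_shift _ _ _ _ _ (- s)) in Hx.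
    rewrite shift_shift, Rplus_opp_r, shift_0 in Hx.
    replace (0 - - s) with s in Hx by ring.
    exists (fun t => x (t + - s)). destruct Hx as (H1 & H2 & H3 & H4 & H5).
    split; [|split; [|split; [|split]]]; auto.
    - intros a b d Ha Hd Hb. lra.
    - lra.
    - intros a b Ha Hb Hab. apply H4; lra.
    - eapply ae_impl; [|exact H5]. intros t Ht Hst. apply Ht. lra. }
  assert (HUg : UUB g) by now apply Omega_UUB with T f tau.
  split; [easy|]. split; [easy|].
  apply pullback_attractor_exists; auto.
  - intros s x0 t v v' H H'.
    apply (sol_val_unique0 T f (shift g s) x0 (t - s)); auto using Omega_Hull.
  - intros s x0 t v eps Hv He.
    destruct (flow_value_continuity T f (shift g s) x0 (t - s) v eps) as (d & V & Hd & _ & Vg & H);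
      auto using Omega_Hull.
    exists d. split; [easy|]. intros x0' v' Hx Hv'. apply (H (shift g s) x0'); auto using Omega_Hull.
Qed.
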